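(* Let $n\ge 2$. Let $f\in\mathcal{P}_n$ with $f\ge 0$ and degree $m\ge 2$. Then: (i) There is a constant $R>1$ depending only on $n$ such that for any $\varepsilon>0$ there exists a global solution $u$ to the thin obstacle problem in $\mathbb{R}^{n+1}$ with polynomial growth of order $m$, whose contact set $\Lambda(u)$ satisfies $$\bigl(\{f=0\}\times\{0\}\bigr)\cap B_1\subset\Lambda(u)\subset\{(x',0)\in\mathbb{R}^{n+1}:\ \mathrm{dist}(x',\{f=0\})\le\varepsilon\}\cap B_R.$$ (ii) For any $\varepsilon>0$ there exists a global solution $u$ to the thin obstacle problem in $\mathbb{R}^{n+1}$ with polynomial growth of some order $m_\varepsilon$ depending on $\varepsilon$, whose contact set $\Lambda(u)$ satisfies $$\bigl(\{f=0\}\times\{0\}\bigr)\cap B_1\subset\Lambda(u)\subset\{(x',0)\in\mathbb{R}^{n+1}:\ \mathrm{dist}(x',\{f=0\})\le\varepsilon\}\cap B_{1+\varepsilon}.$$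
   Context: Write $x=(x',x_{n+1})\in\mathbb{R}^n\times\mathbb{R}$; $B_r$ is the ball of radius $r$ centered at the origin in $\mathbb{R}^{n+1}$; $\mathcal{P}_n$ is the set of (real) polynomials in $\mathbb{R}^n$. A global solution to the thin obstacle problem in $\mathbb{R}^{n+1}$ is a continuous function $u:\mathbb{R}^{n+1}\to\mathbb{R}$ such that: $u\ge 0$ on $\{x_{n+1}=0\}$; $\Delta u=0$ in $\mathbb{R}^{n+1}\setminus\{x_{n+1}=0,\ u=0\}$; $\Delta u\le 0$ in $\mathbb{R}^{n+1}$ (in the weak, i.e. distributional or viscosity, sense); and $u(x',x_{n+1})=u(x',-x_{n+1})$ in $\mathbb{R}^{n+1}$. Its contact set is $\Lambda(u)=\{(x',0): x'\in\mathbb{R}^n,\ u(x',0)=0\}$. A function $u:\mathbb{R}^{n+1}\to\mathbb{R}$ has polynomial growth if there is some $m\in\mathbb{N}$ such that $\left\|\frac{u(x)}{1+|x|^m}\right\|_{L^\infty(\mathbb{R}^{n+1})}<+\infty$; the smallest such $m$ is the order of the polynomial growth of $u$. *)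

(* Defs.v *)
From mathcomp Require Import all_boot all_order all_algebra.
From mathcomp Require Import all_classical all_reals all_analysis.
(* The notations of [mpoly] are not imported, as they clash with
   those of MathComp-Analysis. *)
From mathcomp Require mpoly.
Import (coercions, canonicals) mpoly.

Set Implicit Arguments.
Unset Strict Implicit.
Unset Printing Implicit Defensive.

Import Order.TTheory GRing.Theory Num.Theory.
Import numFieldNormedType.Exports.

Local Open Scope classical_set_scope.
Local Open Scope ring_scope.

(* The norm [`|x|] of MathComp-Analysis on row vectors is the sup norm; it is
   used below only through the topology it induces. Balls, distances and growth
   rates are Euclidean. *)
Definition enorm (R : realType) (N : nat) (x : 'rV[R]_N) : R :=
  Num.sqrt (\sum_(i < N) x 0 i ^+ 2).

Definition eball (R : realType) (N : nat) (r : R) : set 'rV[R]_N :=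
  [set x | enorm x < r].

(* Extended-real valued, so that the distance to the empty set is [+oo]. *)
Definition edist_to (R : realType) (N : nat) (A : set 'rV[R]_N) (x : 'rV[R]_N)
    : \bar R :=
  ereal_inf [set (enorm (x - y))%:E | y in A].

Definition partial (R : realType) (N : nat) (i : 'I_N) (u : 'rV[R]_N -> R)
    : 'rV[R]_N -> R :=
  fun x => 'D_(delta_mx 0 i) u x.

(* [u] is C^2 on [A], which is meant to be open: the partial derivatives of
   order at most 2 exist and are continuous at every point of [A]. *)
Definition C2_on (R : realType) (N : nat) (A : set 'rV[R]_N)
    (u : 'rV[R]_N -> R) : Prop :=
  forall x, A x ->
    [/\ {for x, continuous u},
        forall i : 'I_N,
          derivable u x (delta_mx 0 i) /\ {for x, continuous (partial i u)} &
        forall i j : 'I_N,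
          derivable (partial i u) x (delta_mx 0 j) /\
          {for x, continuous (partial j (partial i u))}].

Definition laplacian (R : realType) (N : nat) (u : 'rV[R]_N -> R)
    (x : 'rV[R]_N) : R :=
  \sum_(i < N) partial i (partial i u) x.

Definition harmonic_on (R : realType) (N : nat) (A : set 'rV[R]_N)
    (u : 'rV[R]_N -> R) : Prop :=
  C2_on A u /\ forall x, A x -> laplacian u x = 0.

(* [laplacian u <= 0] on the whole space in the viscosity sense: every C^2
   function touching the continuous function [u] from below at [x0] has a
   nonpositive Laplacian at [x0]. *)
Definition viscosity_superharmonic (R : realType) (N : nat)
    (u : 'rV[R]_N -> R) : Prop :=
  forall (x0 : 'rV[R]_N) (A : set 'rV[R]_N) (phi : 'rV[R]_N -> R),
    open A -> A x0 -> C2_on A phi ->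
    phi x0 = u x0 -> (forall x, A x -> phi x <= u x) ->
    laplacian phi x0 <= 0.

(* The point [(x', t)] of R^n x R. *)
Definition pt (R : realType) (n : nat) (x' : 'rV[R]_n) (t : R)
    : 'rV[R]_(n + 1) :=
  row_mx x' t%:M.

Definition contact_set (R : realType) (n : nat) (u : 'rV[R]_(n + 1) -> R)
    : set 'rV[R]_(n + 1) :=
  [set pt x' 0 | x' in [set x' : 'rV[R]_n | u (pt x' 0) = 0]].

Record global_solution (R : realType) (n : nat) (u : 'rV[R]_(n + 1) -> R)
    : Prop := GlobalSolution {
  gs_continuous : continuous u;
  gs_ge0 : forall x' : 'rV[R]_n, 0 <= u (pt x' 0);
  gs_harmonic : harmonic_on (~` contact_set u) u;
  gs_superharmonic : viscosity_superharmonic u;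
  gs_even : forall (x' : 'rV[R]_n) (t : R), u (pt x' t) = u (pt x' (- t))
}.

(* The supremum of [|u| / (1 + |x|^m)] is its L^oo norm when [u] is continuous,
   as global solutions are. *)
Definition polynomial_growth (R : realType) (N : nat) (u : 'rV[R]_N -> R)
    (m : nat) : Prop :=
  (ereal_sup (range (fun x => `|u x / (1 + enorm x ^+ m)|%:E)) < +oo)%E.

Definition polynomial_growth_order (R : realType) (N : nat)
    (u : 'rV[R]_N -> R) (m : nat) : Prop :=
  polynomial_growth u m /\ forall k, polynomial_growth u k -> (m <= k)%N.

Definition peval (R : realType) (n : nat) (f : mpoly.mpoly n R)
    (x' : 'rV[R]_n) : R :=
  mpoly.meval (fun i => x' 0 i) f.

(* [msize] is the total degree plus one, and 0 for the zero polynomial. *)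
Definition has_degree (R : realType) (n : nat) (f : mpoly.mpoly n R) (m : nat)
    : Prop :=
  mpoly.msize f = m.+1.

Definition zero_set (R : realType) (n : nat) (f : mpoly.mpoly n R)
    : set 'rV[R]_n :=
  [set x' | peval f x' = 0].

(* The two inclusions on the contact set, the outer one with the ball of
   radius [r]. *)
Definition contact_set_approximates (R : realType) (n : nat)
    (f : mpoly.mpoly n R) (eps r : R) (u : 'rV[R]_(n + 1) -> R) : Prop :=
  [set pt x' 0 | x' in zero_set f] `&` @eball R (n + 1) 1 `<=` contact_set u /\
  contact_set u `<=`
    [set pt x' 0 | x' in [set x' | (edist_to (zero_set f) x' <= eps%:E)%E]]
      `&` @eball R (n + 1) r.

(* Main.v *)
(* Let [q] be [|x'|^(2k) - (1 + 2k)] and [p] the even harmonic extension to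
   R^(n+1) of the polynomial [f + delta q], which is positive for [|x'| >= R_k]
   with [R_k = 2] if [k = 1] and [R_k -> 1] as [k -> oo]. The solution is
   [u = p + G], where [G >= 0] is the least superharmonic function lying above
   [- p] on the thin space. There is an explicit superharmonic function [h >= 0]
   with [h = - q] on the unit ball of the thin space and [h >= - q] on the whole of
   it; thus [0 <= G <= delta h], and [u] vanishes where [f = 0] in the unit ball,
   is positive where [f + delta q > 0], and grows like [p].

   [G] is obtained by Perron's method. The thin obstacle is first replaced by the
   thick one [max (0, - p - M |x_(n+1)|)], cut off away from a cube: it is Lipschitz,
   so translating supersolutions shows that [G] is Lipschitz, and off the thin space
   it is locally the maximum of 0 and a harmonic polynomial, so that contact with it
   there does not matter. [G] is then harmonic off the contact set because
   replacing it in a small ball by the harmonic function with the same boundary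
   values gives again a supersolution. The Dirichlet problem in a ball is solved
   first for polynomial data, and in general by Bernstein approximation and interior
   gradient estimates. *)
Require Import Defs.
From mathcomp Require Import all_boot all_order all_algebra.
From mathcomp Require Import all_classical all_reals all_analysis.
From mathcomp Require mpoly.
From mathcomp Require Import ring lra.
Import (coercions, canonicals) mpoly.

Set Implicit Arguments.
Unset Strict Implicit.
Unset Printing Implicit Defensive.

Import Order.TTheory GRing.Theory Num.Theory.
Import numFieldNormedType.Exports.

Local Open Scope classical_set_scope.
Local Open Scope ring_scope.

(** The constant 1 + 2k is forced by the barrier: c - |x|^(2k) continues across the unit sphere by a
    multiple of 1/|x| with the same value and slope only for c = 1 + 2k, and 1/|x| is superharmonic
    because n + 1 >= 3. On the contact set, f + delta |x'|^(2k) <= delta (1 + 2k). Both terms on the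
    left are nonnegative, so k alone bounds the radius, and then delta alone controls the distance
    to {f = 0}. As G is bounded, u grows at most with order max(m, 2k). Its trace dominates f up to
    a constant, so no smaller order than m is possible, and k = 1 gives exactly m. Viscosity
    superharmonicity passes to infima, translates and glued functions without any integration; the
    comparison principle on balls takes the place of mean values and of the Poisson kernel. *)

Local Notation mpol N R := (mpoly.mpoly N R).
Local Notation mvar i := (mpoly.mpolyX _ (mpoly.mnm1 i)).
Local Notation mdv := mpoly.mderiv.

(** * Polynomial functions *)

Section PolynomialFunctions.
Context {R : realType} {N : nat}.
Implicit Types (P Q : mpol N R) (x y v : 'rV[R]_N) (i j : 'I_N).

(** Induction on how a polynomial is built from constants and variables: derivatives, continuity,
    Lipschitz bounds and substitution then need only the sum and product rules, never monomials. *)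
Lemma mpoly_ring_ind (K : mpol N R -> Prop) :
  (forall c, K (mpoly.mpolyC N c)) -> (forall i, K (mvar i)) ->
  (forall P Q, K P -> K Q -> K (P + Q)) ->
  (forall P Q, K P -> K Q -> K (P * Q)) ->
  forall P, K P.
Proof.
move=> KC KX KD KM; elim/mpoly.mpolyind => [|c m P _ _ KP].
  by rewrite -(mpoly.mpolyC0 N R); exact: KC.
apply: KD => //; rewrite -mpoly.mul_mpolyC; apply: (KM); first exact: KC.
rewrite mpoly.mpolyXE_id; apply: (big_ind K) => [|? ?|i _]; [|exact: KM|].
  by rewrite -(mpoly.mpolyC1 N R); exact: KC.
elim: (m i) => [|k IHk]; first by rewrite expr0 -(mpoly.mpolyC1 N R); exact: KC.
by rewrite exprS; exact: KM.
Qed.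

Lemma pevalC (c : R) x : peval (mpoly.mpolyC N c) x = c.
Proof. exact: mpoly.mevalC. Qed.

Lemma pevalX i x : peval (mvar i) x = x 0 i.
Proof. exact: mpoly.mevalXU. Qed.

Lemma peval0 x : peval 0 x = 0 :> R.
Proof. exact: mpoly.meval0. Qed.

Lemma pevalD P Q x : peval (P + Q) x = peval P x + peval Q x.
Proof. exact: mpoly.mevalD. Qed.

Lemma pevalN P x : peval (- P) x = - peval P x.
Proof. exact: mpoly.mevalN. Qed.

Lemma pevalB P Q x : peval (P - Q) x = peval P x - peval Q x.
Proof. exact: mpoly.mevalB. Qed.

Lemma pevalM P Q x : peval (P * Q) x = peval P x * peval Q x.
Proof. exact: mpoly.mevalM. Qed.

Lemma pevalZ c P x : peval (c *: P) x = c * peval P x.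
Proof. exact: mpoly.mevalZ. Qed.

Lemma pevalXn P k x : peval (P ^+ k) x = peval P x ^+ k.
Proof.
elim: k => [|k IHk]; last by rewrite !exprS pevalM IHk.
by rewrite !expr0; exact: mpoly.meval1.
Qed.

Lemma pevalMn P k x : peval (P *+ k) x = peval P x *+ k.
Proof. exact: mpoly.mevalMn. Qed.

Lemma peval_sum (I : Type) (r : seq I) (p : pred I) (F : I -> mpol N R) x :
  peval (\sum_(k <- r | p k) F k) x = \sum_(k <- r | p k) peval (F k) x.
Proof.
exact: (big_morph (fun P => peval P x) (fun P Q => pevalD P Q x) (peval0 x)).
Qed.

Definition pevalE :=
  (pevalC, pevalX, peval0, pevalD, pevalN, pevalB, pevalM, pevalZ, pevalXn, pevalMn).

Lemma mdvX i j : mdv i (mvar j) = (mpoly.mpolyC N (i == j)%:R) :> mpol N R.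
Proof.
rewrite mpoly.mderivX mpoly.mnm1E eq_sym; case: eqVneq => [->|_].
  rewrite scale1r; have -> : mpoly.mnm_sub (mpoly.mnm1 j) (mpoly.mnm1 j)
    = mpoly.mnm0 by apply/mpoly.mnmP => k; rewrite mpoly.mnmBE mpoly.mnm0E subnn.
  by rewrite mpoly.mpolyX0 -(mpoly.mpolyC1 N R).
by rewrite scale0r mpoly.mpolyC0.
Qed.

Lemma is_derive_coord x v i : is_derive x v (fun y => y 0 i : R) (v 0 i).
Proof.
have cv : (fun h : R => h^-1 *: ((h *: v + x) 0 i - x 0 i)) @ 0^' --> v 0 i.
  apply: cvg_near_cst; near=> h.
  rewrite !mxE addrK scalerA mulVf ?scale1r//; near: h; exact: nbhs_dnbhs_neq.
by apply: DeriveDef; [exact: cvgP cv|exact: cvg_lim cv].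
Unshelve. all: by end_near. Qed.

Lemma is_derive_peval P x v :
  is_derive x v (peval P) (\sum_i v 0 i * peval (mdv i P) x).
Proof.
elim/mpoly_ring_ind: P => [c|j|P Q dP dQ|P Q dP dQ].
- have -> : peval (mpoly.mpolyC N c) = cst c :> ('rV_N -> R).
    by apply/funext => y; rewrite pevalC.
  apply: is_derive_eq; rewrite big1// => i _.
  by rewrite mpoly.mderivC peval0 mulr0.
- have -> : peval (mvar j) = (fun y => y 0 j : R) by apply/funext => y; rewrite pevalX.
  apply: is_derive_eq; first exact: is_derive_coord.
  rewrite (bigD1 j)//= mdvX eqxx pevalC mulr1 big1 ?addr0// => i ij.
  by rewrite mdvX (negbTE ij) pevalC mulr0.
- have -> : peval (P + Q) = peval P + peval Q by apply/funext => y; rewrite pevalD.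
  apply: is_derive_eq; rewrite -big_split; apply: eq_bigr => i _ /=.
  by rewrite mpoly.mderivD pevalD mulrDr.
- have -> : peval (P * Q) = peval P * peval Q by apply/funext => y; rewrite pevalM.
  apply: is_derive_eq; rewrite !scaler_sumr -big_split; apply: eq_bigr => i _ /=.
  by rewrite mpoly.mderivM pevalD !pevalM /GRing.scale /=; ring.
Qed.

Lemma partial_peval P i : partial i (peval P) = peval (mdv i P).
Proof.
apply/funext => x; rewrite /partial.
have [_ ->] := is_derive_peval P x (delta_mx 0 i).
rewrite (bigD1 i)//= mxE !eqxx mul1r big1 ?addr0// => j ji.
by rewrite mxE eqxx (negbTE ji) mul0r.
Qed.

Lemma continuous_peval P : continuous (peval P).
Proof.
elim/mpoly_ring_ind: P => [c|j|P Q cP cQ|P Q cP cQ] x.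
- have -> : peval (mpoly.mpolyC N c) = cst c :> ('rV_N -> R).
    by apply/funext => y; rewrite pevalC.
  exact: cst_continuous.
- have -> : peval (mvar j) = (fun y => y 0 j : R) by apply/funext => y; rewrite pevalX.
  exact: coord_continuous.
- have -> : peval (P + Q) = peval P + peval Q by apply/funext => y; rewrite pevalD.
  by apply: continuousD; [exact: cP|exact: cQ].
- have -> : peval (P * Q) = peval P * peval Q by apply/funext => y; rewrite pevalM.
  by apply: continuousM; [exact: cP|exact: cQ].
Qed.

Lemma C2_on_peval (A : set 'rV[R]_N) P : C2_on A (peval P).
Proof.
move=> x _; split; first exact: continuous_peval.
  move=> i; split; first by have [] := is_derive_peval P x (delta_mx 0 i).
  by rewrite partial_peval; exact: continuous_peval.
move=> i j; rewrite !partial_peval; split; last exact: continuous_peval.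
by have [] := is_derive_peval (mdv i P) x (delta_mx 0 j).
Qed.

Definition plap P : mpol N R := \sum_i mdv i (mdv i P).

Lemma laplacian_peval P x : laplacian (peval P) x = peval (plap P) x.
Proof.
by rewrite peval_sum; apply: eq_bigr => i _; rewrite !partial_peval.
Qed.

Lemma plapD P Q : plap (P + Q) = plap P + plap Q.
Proof. by rewrite -big_split; apply: eq_bigr => i _; rewrite !mpoly.mderivD. Qed.

Lemma plapN P : plap (- P) = - plap P.
Proof. by rewrite -sumrN; apply: eq_bigr => i _; rewrite !mpoly.mderivN. Qed.

Lemma plapB P Q : plap (P - Q) = plap P - plap Q.
Proof. by rewrite plapD plapN. Qed.

Lemma plapZ c P : plap (c *: P) = c *: plap P.
Proof. by rewrite scaler_sumr; apply: eq_bigr => i _; rewrite !mpoly.mderivZ. Qed.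

Lemma mdv_sum (I : Type) (r : seq I) (p : pred I) (F : I -> mpol N R) i :
  mdv i (\sum_(k <- r | p k) F k) = \sum_(k <- r | p k) mdv i (F k).
Proof.
exact: (big_morph (mdv i) (mpoly.mderivD i) (mpoly.mderiv0 R i)).
Qed.

Lemma plap_mdv i P : plap (mdv i P) = mdv i (plap P).
Proof.
rewrite mdv_sum; apply: eq_bigr => j _.
by rewrite (mpoly.mderiv_comm i j) (mpoly.mderiv_comm i j).
Qed.

Lemma plapC c : plap (mpoly.mpolyC N c) = 0.
Proof.
by apply: big1 => i _; rewrite mpoly.mderivC mpoly.mderiv0.
Qed.

Lemma plap0 : plap 0 = 0 :> mpol N R.
Proof. by rewrite -(mpoly.mpolyC0 N R) plapC mpoly.mpolyC0. Qed.

Lemma plapM P Q : plap (P * Q) =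
  plap P * Q + P * plap Q + (\sum_i mdv i P * mdv i Q) *+ 2.
Proof.
rewrite /plap mulr_suml mulr_sumr -sumrMnl -!big_split; apply: eq_bigr => i _ /=.
by rewrite !mpoly.mderivM !mpoly.mderivD !mpoly.mderivM; ring.
Qed.

(** Kept as a polynomial so that balls, spheres and quadratic perturbations have formally computable
    gradients and Laplacians, without square roots. *)
Definition sqdist y : mpol N R := \sum_i (mvar i - mpoly.mpolyC N (y 0 i)) ^+ 2.

Lemma peval_sqdist y x : peval (sqdist y) x = \sum_i (x 0 i - y 0 i) ^+ 2.
Proof. by rewrite peval_sum; apply: eq_bigr => i _; rewrite !pevalE. Qed.

Lemma mdv_sqdist i y : mdv i (sqdist y) = (mvar i - mpoly.mpolyC N (y 0 i)) *+ 2.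
Proof.
rewrite mdv_sum (bigD1 i)//= big1 ?addr0 => [|j ji]; last first.
  rewrite expr2 mpoly.mderivM mpoly.mderivB mpoly.mderivC mdvX eq_sym (negbTE ji).
  by rewrite mpoly.mpolyC0 subr0 mul0r mulr0 addr0.
rewrite expr2 mpoly.mderivM mpoly.mderivB mpoly.mderivC mdvX eqxx.
by rewrite mpoly.mpolyC1; ring.
Qed.

Lemma plap_sqdist y : plap (sqdist y) = mpoly.mpolyC N (2 * N%:R).
Proof.
rewrite /plap (eq_bigr (fun=> mpoly.mpolyC N (2 : R))) => [|i _].
  by rewrite sumr_const card_ord mulr_natr !mpoly.mpolyCMn.
rewrite mdv_sqdist mpoly.mderivMn mpoly.mderivB mpoly.mderivC mdvX eqxx subr0.
by rewrite /= mulr1n mpoly.mpolyCMn.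
Qed.

End PolynomialFunctions.

(** * C^2 functions and the comparison principle *)

Section C2Functions.
Context {R : realType} {N : nat}.
Implicit Types (u v w phi : 'rV[R]_N -> R) (A B : set 'rV[R]_N) (x y : 'rV[R]_N).

Lemma C2_onS A B u : A `<=` B -> C2_on B u -> C2_on A u.
Proof. by move=> AB uB x /AB; exact: uB. Qed.

Lemma partial_lin c u v i x : derivable u x (delta_mx 0 i) ->
  derivable v x (delta_mx 0 i) ->
  derivable (fun z => c * u z + v z) x (delta_mx 0 i) /\
  partial i (fun z => c * u z + v z) x = c * partial i u x + partial i v x.
Proof.
move=> du dv.
have -> : (fun z => c * u z + v z) = c *: u + v by [].
have d : is_derive x (delta_mx 0 i) (c *: u + v) (c *: partial i u x + partial i v x).
  apply: is_deriveD; first by apply: is_deriveZ; exact: derivableP.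
  exact: derivableP.
by split; [exact: ex_derive|rewrite /partial derive_val].
Qed.

Lemma near_eq_partial u v i x : (\near x, u x = v x) ->
  partial i u x = partial i v x.
Proof. by move=> uv; exact: near_eq_derive. Qed.

Lemma near_eq_continuous u v x : (\near x, u x = v x) ->
  {for x, continuous u} -> {for x, continuous v}.
Proof.
move=> uv cu; rewrite /prop_for /continuous_at -(nbhs_singleton uv).
exact: cvg_trans (near_eq_cvg uv) cu.
Qed.

Lemma C2_on_near_eq A u v : open A -> (forall x, A x -> u x = v x) ->
  C2_on A u -> C2_on A v /\ (forall x, A x -> laplacian v x = laplacian u x).
Proof.
move=> oA uv uA.
have nA x : A x -> \near x, A x by move=> Ax; exact: open_nbhs_nbhs.
have nuv x : A x -> \near x, u x = v x.
  by move=> /nA; apply: filterS => z; exact: uv.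
have dE i x : A x -> partial i u x = partial i v x.
  by move=> Ax; apply: near_eq_partial; exact: nuv.
have ndE i x : A x -> \near x, partial i u x = partial i v x.
  by move=> /nA; apply: filterS => z; exact: dE.
have ddE i j x : A x -> partial j (partial i u) x = partial j (partial i v) x.
  by move=> Ax; apply: near_eq_partial; exact: ndE.
split=> [x Ax|x Ax]; last by apply: eq_bigr => i _; rewrite ddE.
have [cu du ddu] := uA x Ax; split; first exact: near_eq_continuous (nuv _ Ax) cu.
  move=> i; have [d c] := du i; split.
    exact: near_eq_derivable (nuv _ Ax) d.
  exact: near_eq_continuous (ndE _ _ Ax) c.
move=> i j; have [d c] := ddu i j; split.
  exact: near_eq_derivable (ndE _ _ Ax) d.
apply: near_eq_continuous c; apply: filterS (nA _ Ax) => z; exact: ddE.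
Qed.

Lemma continuous_lin c u v x : {for x, continuous u} -> {for x, continuous v} ->
  {for x, continuous (fun z => c * u z + v z)}.
Proof.
move=> cu cv; apply: continuousD => //.
by apply: continuousM => //; exact: cst_continuous.
Qed.

Lemma continuous_pow u k x : {for x, continuous u} ->
  {for x, continuous (fun z => u z ^+ k)}.
Proof.
move=> cu; elim: k => [|k IHk].
  have -> : (fun z => u z ^+ 0) = (fun=> 1) by apply/funext => z; rewrite expr0.
  exact: cst_continuous.
have -> : (fun z => u z ^+ k.+1) = u * (fun z => u z ^+ k).
  by apply/funext => z; rewrite exprS.
exact: continuousM.
Qed.

Lemma C2_on_lin A c u v : open A -> C2_on A u -> C2_on A v ->
  C2_on A (fun x => c * u x + v x) /\
  (forall x, A x ->
     laplacian (fun x => c * u x + v x) x = c * laplacian u x + laplacian v x).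
Proof.
move=> oA uA vA.
have nA x : A x -> \near x, A x by move=> Ax; exact: open_nbhs_nbhs.
have dE i x : A x ->
    partial i (fun x => c * u x + v x) x = c * partial i u x + partial i v x.
  move=> Ax; have [_ /(_ i)[du _] _] := uA x Ax.
  by have [_ /(_ i)[dv _] _] := vA x Ax; have [] := partial_lin c du dv.
have ndE i x : A x -> \near x,
    c * partial i u x + partial i v x = partial i (fun x => c * u x + v x) x.
  by move=> /nA; apply: filterS => z /dE ->.
have ddE i j x : A x ->
    c * partial j (partial i u) x + partial j (partial i v) x =
    partial j (partial i (fun x => c * u x + v x)) x.
  move=> Ax; rewrite -(near_eq_partial _ (ndE i _ Ax)).
  have [_ _ /(_ i j)[du _]] := uA x Ax; have [_ _ /(_ i j)[dv _]] := vA x Ax.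
  by have [_ ->] := partial_lin c du dv.
split=> [x Ax|x Ax]; last first.
  by rewrite mulr_sumr -big_split; apply: eq_bigr => i _ /=; rewrite ddE.
have [cu du ddu] := uA x Ax; have [cv dv ddv] := vA x Ax.
split; first exact: continuous_lin.
  move=> i; have [d1 c1] := du i; have [d2 c2] := dv i; split.
    by have [] := partial_lin c d1 d2.
  exact: (near_eq_continuous (ndE _ _ Ax) (continuous_lin (c := c) c1 c2)).
move=> i j; have [d1 c1] := ddu i j; have [d2 c2] := ddv i j; split.
  have [d _] := partial_lin c d1 d2.
  by apply: near_eq_derivable d; exact: ndE.
apply: (near_eq_continuous _ (continuous_lin (c := c) c1 c2)).
by apply: filterS (nA _ Ax) => z; exact: ddE.
Qed.

Lemma is_derive_line w x (e : 'rV[R]_N) (t : R) : derivable w (t *: e + x) e ->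
  is_derive t 1 (fun s => w (s *: e + x)) ('D_e w (t *: e + x)).
Proof.
move=> dw.
have E : (fun h : R => h^-1 *: (((fun s => w (s *: e + x)) \o shift t) (h *: 1) -
      w (t *: e + x))) =
    (fun h : R => h^-1 *: ((w \o shift (t *: e + x)) (h *: e) - w (t *: e + x))).
  by apply/funext => h /=; rewrite [h *: 1]mulr1 scalerDl addrA.
by split; [rewrite /derivable E|rewrite /derive E].
Qed.

End C2Functions.

(** If [d2 < 0], then [dg] is negative just to the right of 0, where it vanishes, and the mean value
    theorem makes [g] drop below [g 0]. Only differentiability of [dg] at 0 itself enters. *)
Lemma second_derivative_min {R : realType} (g dg : R -> R) (d2 e : R) : 0 < e ->
  (forall t : R, `|t| < e -> is_derive t 1 g (dg t)) -> is_derive (0 : R) 1 dg d2 ->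
  (forall t, `|t| < e -> g 0 <= g t) -> 0 <= d2.
Proof.
move=> e0 dgP d2P gmin.
have itvE t : t \in `](- e), e[%R = (`|t| < e) by rewrite in_itv/= ltr_norml.
have dg0 : dg 0 = 0.
  have d0 : is_derive (0 : R) 1 g 0.
    apply: (@derive1_at_min _ g (- e) e 0).
    - by lra.
    - by move=> t; rewrite itvE => /dgP d; exact: ex_derive.
    - by rewrite itvE normr0.
    - by move=> t; rewrite itvE; exact: gmin.
  have /dgP d1 : `|0 : R| < e by rewrite normr0.
  by rewrite -(@derive_val _ _ _ _ _ _ _ d1) (@derive_val _ _ _ _ _ _ _ d0).
rewrite leNgt; apply/negP => d2neg.
have [] := d2P => /cvg_ex[l /= cl]; rewrite /derive (cvg_lim _ cl)// => l2.
move: cl; rewrite {}l2 => /cvgr_lt/(_ 0 d2neg).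
move=> /nbhs_ballP[r /= r0 hr].
pose h := Num.min r e / 2.
have m0 : 0 < Num.min r e by rewrite lt_min r0 e0.
have h0 : 0 < h by rewrite divr_gt0.
have hm : h < Num.min r e by rewrite /h ltr_pdivrMr// ltr_pMr// ltr1n.
have hE t : 0 <= t -> t <= h -> `|t| < e /\ `|t| < r.
  move=> t0 th; rewrite ger0_norm//; move: hm; rewrite lt_min => /andP[h1 h2].
  by split; exact: le_lt_trans th _.
have [h1 _] := hE h (ltW h0) (lexx _).
have [c] : exists2 c, c \in `]0, h[%R & g h - g 0 = dg c * (h - 0).
  apply: MVT => // [t|].
    by rewrite in_itv/= => /andP[/ltW t0 /ltW th]; apply: dgP; have [] := hE t t0 th.
  apply: derivable_within_continuous => t; rewrite in_itv/= => /andP[t0 th].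
  by have [/dgP d _] := hE t t0 th; exact: ex_derive.
rewrite in_itv/= => /andP[c0 ch].
have [c1 c2] := hE c (ltW c0) (ltW ch).
have : c^-1 * (dg c - dg 0) < 0.
  have := hr c; rewrite /ball /= sub0r normrN => /(_ c2 (lt0r_neq0 c0)).
  by rewrite addr0 [c *: 1]mulr1.
rewrite dg0 subr0 subr0 pmulr_rlt0 ?invr_gt0// => dc gE.
have := gmin h h1; rewrite -subr_ge0 gE leNgt => /negP; apply.
by rewrite nmulr_rlt0.
Qed.

Section Comparison.
Context {R : realType} {N : nat}.
Implicit Types (u v w phi : 'rV[R]_N -> R) (A B : set 'rV[R]_N) (x y : 'rV[R]_N).

(* Balls are parametrised by the square [s] of the radius. *)
Definition dball y (s : R) : set 'rV[R]_N := [set x | peval (sqdist y) x < s].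
Definition cball y (s : R) : set 'rV[R]_N := [set x | peval (sqdist y) x <= s].

Lemma sqdist_ge0 y x : 0 <= peval (sqdist y) x.
Proof. by rewrite peval_sqdist sumr_ge0// => i _; rewrite sqr_ge0. Qed.

Lemma sqdistxx y : peval (sqdist y) y = 0.
Proof. by rewrite peval_sqdist big1// => i _; rewrite subrr expr0n. Qed.

Lemma sqdist_coord y x i : (x 0 i - y 0 i) ^+ 2 <= peval (sqdist y) x.
Proof.
rewrite peval_sqdist (bigD1 i)//= lerDl sumr_ge0// => j _; exact: sqr_ge0.
Qed.

Lemma normr_coord x i : `|x 0 i| <= `|x|.
Proof.
rewrite [leRHS]/Num.norm/= mx_normrE.
by apply: le_trans (le_bigmax _ _ (0, i)).
Qed.

Lemma normr_rV_le x (a : R) : 0 <= a -> (forall i, `|x 0 i| <= a) -> `|x| <= a.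
Proof.
move=> a0 xa; rewrite [leLHS]/Num.norm/= mx_normrE; apply/bigmax_leP; split => //.
by move=> [i j] _ /=; rewrite ord1.
Qed.

Lemma norm_le_sqdist y x : `|x - y| ^+ 2 <= peval (sqdist y) x.
Proof.
rewrite -[leRHS]sqr_sqrtr ?sqdist_ge0// lerXn2r ?nnegrE ?sqrtr_ge0//.
apply: normr_rV_le => [|i]; first exact: sqrtr_ge0.
by rewrite !mxE -sqrtr_sqr ler_wsqrtr// sqdist_coord.
Qed.

Lemma dball_cball y s : dball y s `<=` cball y s.
Proof. by move=> x /ltW. Qed.

Lemma dball_center y s : 0 < s -> dball y s y.
Proof. by rewrite /dball /= sqdistxx. Qed.

Lemma open_dball y s : open (dball y s).
Proof.
have -> : dball y s = peval (sqdist y) @^-1` [set r | r < s] by [].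
apply: open_comp => [x _|]; first exact: continuous_peval.
exact: open_lt.
Qed.

Lemma closed_cball y s : closed (cball y s).
Proof.
have -> : cball y s = peval (sqdist y) @^-1` [set r | r <= s] by [].
apply: closed_comp => [x _|]; first exact: continuous_peval.
exact: closed_le.
Qed.

Lemma compact_cball y s : compact (cball y s).
Proof.
apply: bounded_closed_compact; last exact: closed_cball.
(* [s + 1] bounds the radius sqrt s, since 2a <= a^2 + 1. *)
exists (`|y| + (s + 1)); split=> [|M /ltW yM x /= xs]; first exact: num_real.
apply: le_trans yM; rewrite -[x](subrK y) (le_trans (ler_normD _ _))// addrC lerD2l.
have h := le_trans (norm_le_sqdist y x) xs.
have := sqr_ge0 (`|x - y| - 1); have := normr_ge0 (x - y).
move: h; set a := `|x - y|; nra.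
Qed.

Lemma nbhs_cball A x : nbhs x A -> exists2 s, 0 < s & cball x s `<=` A.
Proof.
move=> /nbhs_ballP[e /= e0 eA]; exists ((e / 2) ^+ 2) => [|z zs].
  by rewrite exprn_gt0// divr_gt0.
apply: eA; rewrite -ball_normE /= distrC.
have h := le_trans (norm_le_sqdist x z) zs.
have : `|z - x| <= e / 2 by rewrite -ler_sqr ?nnegrE// ltW// divr_gt0.
by move/le_lt_trans; apply; rewrite ltr_pdivrMr// ltr_pMr// ltr1n.
Qed.

(** The value at [a] is below all values on the sphere, so the minimum over the compact ball is
    attained inside. *)
Lemma interior_min y s u a : 0 < s ->
  (forall x, cball y s x -> {for x, continuous u}) ->
  dball y s a -> (forall z, peval (sqdist y) z = s -> u a < u z) ->
  exists2 z, dball y s z & forall x, cball y s x -> u z <= u x.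
Proof.
move=> s0 uc ya uza.
have [z] : exists2 z, z \in cball y s & forall x, x \in cball y s -> u z <= u x.
  apply: compact_EVT_min; [by exists a; exact: dball_cball|exact: compact_cball|].
  by apply: continuous_in_subspaceT => x; rewrite inE; exact: uc.
rewrite inE => yz zmin; exists z => [|x xs]; last by apply: zmin; rewrite inE.
rewrite /dball /= lt_neqAle; apply/andP; split => //; apply/eqP => /uza.
by rewrite ltNge zmin// inE; exact: dball_cball.
Qed.

Definition visc_super_on B u : Prop :=
  forall (x0 : 'rV[R]_N) A phi, open A -> A x0 -> B x0 -> C2_on A phi ->
    phi x0 = u x0 -> (forall x, A x -> phi x <= u x) -> laplacian phi x0 <= 0.

Lemma laplacian_min A w x : open A -> A x -> C2_on A w ->
  (forall z, A z -> w x <= w z) -> 0 <= laplacian w x.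
Proof.
move=> oA Ax wA wmin; apply: sumr_ge0 => i _.
pose e : 'rV[R]_N := delta_mx 0 i.
have /nbhs_ballP[r /= r0 rA] : nbhs x A by exact: open_nbhs_nbhs.
have lA (t : R) : `|t| < r -> A (t *: e + x).
  move=> tr; apply: rA; rewrite -ball_normE /= opprD addrCA subrr addr0 normrN.
  apply: le_lt_trans tr; apply: normr_rV_le => // j; rewrite !mxE.
  by case: (_ && _); rewrite ?mulr1 ?mulr0 ?normr0.
have d1 t : `|t| < r ->
    is_derive t (1 : R) (fun t => w (t *: e + x)) (partial i w (t *: e + x)).
  move=> /lA Axt; have [_ /(_ i)[dw _] _] := wA _ Axt.
  exact: is_derive_line.
have E : (0 : R) *: e + x = x by rewrite scale0r add0r.
have d2 : is_derive (0 : R) (1 : R) (fun t => partial i w (t *: e + x))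
    (partial i (partial i w) x).
  have [_ _ /(_ i i)[d _]] := wA _ Ax.
  rewrite -[X in partial i (partial i w) X]E.
  by apply: is_derive_line; rewrite E.
apply: (second_derivative_min r0 d1 d2) => t /lA Axt.
by rewrite E; exact: wmin.
Qed.

(** Where [phi] touches [u] from below, [u - phi] has a local minimum and hence a nonnegative
    Laplacian. *)
Lemma C2_superharmonic_visc A u : open A -> C2_on A u ->
  (forall x, A x -> laplacian u x <= 0) -> visc_super_on A u.
Proof.
move=> oA uA ulap x0 B phi oB Bx0 Ax0 phiB phiu phi_le.
have oAB : open (A `&` B) by exact: openI.
have uAB : C2_on (A `&` B) u by apply: C2_onS uA => ? [].
have phiAB : C2_on (A `&` B) phi by apply: C2_onS phiB => ? [].
have [wAB wlap] := C2_on_lin (-1) oAB phiAB uAB.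
have := wlap x0 (conj Ax0 Bx0).
have : 0 <= laplacian (fun x => -1 * phi x + u x) x0.
  apply: laplacian_min oAB (conj Ax0 Bx0) wAB _ => z [Az Bz].
  by rewrite !mulN1r phiu addNr addrC subr_ge0 phi_le.
move=> H E; move: H; rewrite E mulN1r addrC subr_ge0 => /le_trans.
by apply; exact: ulap.
Qed.

(** If [w a < u a], add a small multiple of |x - y|^2 to [u], making it strictly subharmonic. The
    difference with [w] still has an interior minimum, where a translate of the perturbed [u]
    touches [w] from below with positive Laplacian. *)
Lemma comparison (N0 : (0 < N)%N) y s u w : 0 < s ->
  (forall x, cball y s x -> {for x, continuous u}) ->
  (forall x, cball y s x -> {for x, continuous w}) ->
  C2_on (dball y s) u -> (forall x, dball y s x -> 0 <= laplacian u x) ->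
  visc_super_on (dball y s) w ->
  (forall z, peval (sqdist y) z = s -> u z <= w z) ->
  forall x, cball y s x -> u x <= w x.
Proof.
move=> s0 uc wc uC2 ulap wsup uw a; rewrite /cball /= le_eqVlt.
move=> /orP[/eqP/uw//|ya]; rewrite leNgt; apply/negP => wua.
(* On the sphere the perturbation [eta * s] uses up only half of the gap at [a]. *)
pose eta := (u a - w a) / (s *+ 2).
have eta0 : 0 < eta by rewrite divr_gt0 ?subr_gt0// mulrn_wgt0.
have etaE : eta * s = (u a - w a) / 2.
  by rewrite /eta; field; rewrite gt_eqF.
pose phi := fun x => 1 * u x + peval (eta *: sqdist y) x.
have phiE x : phi x = u x + eta * peval (sqdist y) x by rewrite /phi pevalZ mul1r.
have phic x : cball y s x -> {for x, continuous phi}.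
  by move=> /uc ux; apply: continuous_lin => //; exact: continuous_peval.
have fc x : cball y s x -> {for x, continuous (fun z => -1 * phi z + w z)}.
  by move=> xs; apply: continuous_lin; [exact: phic|exact: wc].
have [|z yz zmin] := interior_min s0 fc ya.
  move=> z zs; rewrite !phiE zs etaE; have := uw z zs.
  have : 0 <= eta * peval (sqdist y) a by rewrite mulr_ge0 ?sqdist_ge0// ltW.
  lra.
have C2cst : C2_on (dball y s) (peval (eta *: sqdist y)) by exact: C2_on_peval.
have [phiC2 philap] := C2_on_lin 1 (@open_dball y s) uC2 C2cst.
have C2c : C2_on (dball y s) (peval (mpoly.mpolyC N (w z - phi z))).
  exact: C2_on_peval.
have [psiC2 psilap] := C2_on_lin 1 (@open_dball y s) phiC2 C2c.
have := wsup z _ _ (@open_dball y s) yz yz psiC2.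
rewrite psilap// philap// !laplacian_peval plapC plapZ plap_sqdist !pevalE.
rewrite addr0 !mul1r => H.
have : laplacian u z + eta * (2 * N%:R) <= 0.
  apply: H => [|x xs]; first by rewrite /phi pevalZ mul1r; ring.
  have := zmin _ (dball_cball xs); rewrite pevalC pevalZ !phiE; lra.
apply/negP; rewrite -ltNge ltr_wpDl ?ulap// mulr_gt0// mulr_gt0// ltr0n//.
Qed.

End Comparison.

(** * Harmonic polynomials and their limits *)

Section HarmonicPolynomials.
Context {R : realType} {N : nat}.
Implicit Types (u v w : 'rV[R]_N -> R) (A B : set 'rV[R]_N) (x y : 'rV[R]_N).
Implicit Types (P Q : mpol N R).

Definition gdot P Q x : R := \sum_i peval (mdv i P) x * peval (mdv i Q) x.

Lemma peval_plapM P Q x : peval (plap (P * Q)) x =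
  peval (plap P) x * peval Q x + peval P x * peval (plap Q) x + gdot P Q x *+ 2.
Proof.
rewrite plapM pevalD pevalMn pevalD 2!pevalM [X in _ + X *+ 2]peval_sum.
by congr (_ + _ *+ 2); apply: eq_bigr => i _; rewrite pevalM.
Qed.

Lemma gdot_sqr P Q x :
  gdot (P * P) (Q * Q) x = 4 * (peval P x * peval Q x * gdot P Q x).
Proof.
rewrite /gdot !(@mulr_sumr _ 'I_N); apply: eq_bigr => i _.
by rewrite !mpoly.mderivM !pevalD !pevalM; ring.
Qed.

(** The right-hand side is the squared length of c grad P + d grad Q; it will absorb the cross term
    in the gradient estimate. *)
Lemma gdot_young P Q (c d : R) x :
  0 <= c ^+ 2 * gdot P P x + (c * d * gdot P Q x) *+ 2 + d ^+ 2 * gdot Q Q x.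
Proof.
have -> : c ^+ 2 * gdot P P x + (c * d * gdot P Q x) *+ 2 + d ^+ 2 * gdot Q Q x =
    \sum_i (c * peval (mdv i P) x + d * peval (mdv i Q) x) ^+ 2.
  rewrite /gdot !(@mulr_sumr _ 'I_N) -sumrMnl -!big_split; apply: eq_bigr => i _ /=.
  by ring.
by apply: sumr_ge0 => i _; exact: sqr_ge0.
Qed.

Lemma gdot_sqdist y x : gdot (sqdist y) (sqdist y) x = 4 * peval (sqdist y) x.
Proof.
rewrite peval_sqdist (@mulr_sumr _ 'I_N); apply: eq_bigr => i _.
by rewrite mdv_sqdist !pevalE; ring.
Qed.

Lemma max_principle (N0 : (0 < N)%N) y s P (c : R) : 0 < s ->
  (forall x, dball y s x -> 0 <= peval (plap P) x) ->
  (forall z, peval (sqdist y) z = s -> peval P z <= c) ->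
  forall x, cball y s x -> peval P x <= c.
Proof.
move=> s0 Plap Pc x xs.
rewrite -(pevalC (N := N) c x).
apply: (comparison N0 s0 _ _ _ _ _ _ xs).
- by move=> z _; exact: continuous_peval.
- by move=> z _; exact: continuous_peval.
- exact: C2_on_peval.
- by move=> z zs; rewrite laplacian_peval; exact: Plap.
- apply: C2_superharmonic_visc; [exact: open_dball|exact: C2_on_peval|].
  by move=> z _; rewrite laplacian_peval plapC peval0.
- by move=> z zs; rewrite pevalC; exact: Pc.
Qed.

(** This is sqrt K / (s / 2), with K = (12 + 2N) s the constant of the next proof and s / 2 a lower
    bound for s - |x - y|^2 on the ball of squared radius s / 4. *)
Definition grad_const (s : R) : R := Num.sqrt ((48 + 8 * N%:R) / s).

(* Bernstein's technique: with [b] vanishing on the sphere and [v] a partial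
   derivative of [P], [b^2 v^2 + K P^2] is subharmonic for [K] large. *)
Lemma harmonic_grad_le (N0 : (0 < N)%N) y s P (a : R) i : 0 < s -> plap P = 0 ->
  (forall x, cball y s x -> `|peval P x| <= a) ->
  forall x, cball y (s / 4) x -> `|peval (mdv i P) x| <= grad_const s * a.
Proof.
move=> s0 hP Pa.
have a0 : 0 <= a by apply: le_trans (normr_ge0 _) (Pa y _); rewrite /cball/= sqdistxx ltW.
pose b := mpoly.mpolyC N s - sqdist y.
pose v := mdv i P.
(* Once the cross term is absorbed, the Laplacian of b^2 v^2 is at least -(24 + 4N) s v^2, while
   that of K P^2 is 2K |grad P|^2 >= 2K v^2. *)
pose K := (12 + 2 * N%:R) * s.
have K0 : 0 <= K by rewrite mulr_ge0 ?addr_ge0 ?mulr_ge0// ltW.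
have hv : plap v = 0 by rewrite /v plap_mdv hP mpoly.mderiv0.
have hb : plap b = mpoly.mpolyC N (- (2 * N%:R)).
  by rewrite /b plapB plapC plap_sqdist sub0r mpoly.mpolyCN.
have key x : cball y s x ->
    peval (b * b * (v * v) + K *: (P * P)) x <= K * a ^+ 2.
  apply: (max_principle N0) => // {}x.
    move=> xs; rewrite plapD plapZ pevalD pevalZ !peval_plapM gdot_sqr hP hv hb.
    rewrite pevalC !peval0.
    have -> : gdot b b x = 4 * peval (sqdist y) x.
      rewrite -gdot_sqdist; apply: eq_bigr => j _.
      by rewrite /b mpoly.mderivB mpoly.mderivC !pevalB peval0 !sub0r mulrNN.
    have BE : peval b x = s - peval (sqdist y) x by rewrite /b pevalB pevalC.
    have := gdot_young b v (2 * peval v x) (peval b x) x.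
    have -> : gdot b b x = 4 * peval (sqdist y) x.
      rewrite -gdot_sqdist; apply: eq_bigr => j _.
      by rewrite /b mpoly.mderivB mpoly.mderivC !pevalB peval0 !sub0r mulrNN.
    have : K * peval v x ^+ 2 <= K * gdot P P x.
      rewrite ler_wpM2l// /gdot (bigD1 i)//= -/v -expr2 lerDl sumr_ge0// => j _.
      by rewrite -expr2 sqr_ge0.
    have := sqdist_ge0 y x; move: xs; rewrite /dball /= !pevalM BE /K.
    move: (peval (sqdist y) x) (peval v x) (gdot b v x) (gdot v v x) (gdot P P x).
    move=> q V S G H qs q0 KP sq.
    have n0 : 0 <= N%:R :> R by [].
    have V2 := sqr_ge0 V.
    have sq0 : 0 <= s - q by rewrite subr_ge0 ltW.
    have := mulr_ge0 V2 sq0.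
    have := mulr_ge0 (mulr_ge0 V2 q0) n0.
    move: sq KP; lra.
  move=> xs; rewrite !pevalE xs subrr !mul0r add0r -expr2 ler_wpM2l//.
  have xc : cball y s x by rewrite /cball /= xs.
  by rewrite -[leLHS]real_normK ?num_real// lerXn2r ?nnegrE// Pa.
move=> x xs.
have xc : cball y s x by apply: le_trans xs _; rewrite ler_pdivrMr// ler_pMr// ler1n.
have := key x xc; rewrite !pevalE -!expr2.
set V := peval v x => h.
rewrite -(@ger0_norm _ (grad_const s * a)) ?mulr_ge0 ?sqrtr_ge0//.
rewrite -ler_sqr ?nnegrE// !real_normK ?num_real// exprMn sqr_sqrtr; last first.
  by rewrite divr_ge0 ?addr_ge0 ?mulr_ge0// ltW.
have {h} : (s - peval (sqdist y) x) ^+ 2 * V ^+ 2 <= K * a ^+ 2.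
  by apply: le_trans h; rewrite lerDl mulr_ge0 ?sqr_ge0.
have : (s / 2) ^+ 2 <= (s - peval (sqdist y) x) ^+ 2.
  rewrite lerXn2r ?nnegrE//.
  - by rewrite divr_ge0 ?ltW.
  - by rewrite subr_ge0.
  - move: xs; rewrite /cball /=; lra.
move=> /(ler_wpM2r (sqr_ge0 V))/le_trans h /h {h}.
have -> : (48 + 8 * N%:R) / s * a ^+ 2 = (K * a ^+ 2) / (s / 2) ^+ 2.
  by rewrite /K; field; rewrite gt_eqF.
by rewrite ler_pdivlMr ?exprn_gt0 ?divr_gt0// mulrC.
Qed.

End HarmonicPolynomials.

Lemma mean_value {R : realType} (f df : R -> R) (t : R) :
  (forall s : R, is_derive s (1 : R) f (df s)) ->
  exists2 c, `|c| <= `|t| & f t - f 0 = df c * t.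
Proof.
move=> fdf.
have cf (a b : R) : {within `[a, b], continuous f}.
  by apply: derivable_within_continuous => s _; have [] := fdf s.
have [t0|t0|->] := ltgtP t 0; last by exists 0; rewrite ?subrr ?mulr0.
- have [c] := MVT t0 (fun s _ => fdf s) (cf t 0).
  rewrite in_itv/= => /andP[tc c0] E; exists c.
    by rewrite !ltr0_norm// lerN2 ltW.
  by rewrite -opprB E; ring.
- have [c] := MVT t0 (fun s _ => fdf s) (cf 0 t).
  rewrite in_itv/= => /andP[c0 ct] E; exists c.
    by rewrite !gtr0_norm// ltW.
  by rewrite E subr0.
Qed.

Section HarmonicLimits.
Context {R : realType} {N : nat}.
Implicit Types (u v w H V : 'rV[R]_N -> R) (A B : set 'rV[R]_N) (x y : 'rV[R]_N).
Implicit Types (P Q : nat -> mpol N R).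

Definition ulim P H B := forall e : R, 0 < e -> exists K : nat,
  forall k x, (K <= k)%N -> B x -> `|peval (P k) x - H x| <= e.

Definition ucauchy P B := forall e : R, 0 < e -> exists K : nat,
  forall k l x, (K <= k)%N -> (K <= l)%N -> B x ->
    `|peval (P k) x - peval (P l) x| <= e.

Lemma ulimS P H A B : A `<=` B -> ulim P H B -> ulim P H A.
Proof.
by move=> AB h e /h[K hK]; exists K => k x Kk /AB; exact: hK.
Qed.

Lemma ulim_ucauchy P H B : ulim P H B -> ucauchy P B.
Proof.
move=> h e e0; have [|K hK] := h (e / 2); first by rewrite divr_gt0.
exists K => k l x Kk Kl Bx; have := hK k x Kk Bx; have := hK l x Kl Bx.
by rewrite !ler_norml => /andP[? ?] /andP[? ?]; apply/andP; split; lra.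
Qed.

Lemma ucauchy_ulim P B : ucauchy P B -> exists H, ulim P H B.
Proof.
move=> cP; exists (fun x => lim ((fun k => peval (P k) x) @ \oo)) => e e0.
have [K hK] := cP e e0; exists K => k x Kk Bx.
have cu : cvg ((fun k => peval (P k) x) @ \oo).
  apply: cauchy_cvg; apply/cauchy_ballP => d d0.
  have [|L hL] := cP (d / 2); first by rewrite divr_gt0.
  pose U := [set peval (P l) x | l in [set l | (L <= l)%N]].
  exists (U, U) => /=.
    by split; exists L => // l /= Ll; exists l.
  move=> [_ _] /= [[k1 L1 <-] [k2 L2 <-]]; rewrite /ball /=.
  by apply: le_lt_trans (hL _ _ _ L1 L2 Bx) _; rewrite ltr_pdivrMr// ltr_pMr// ltr1n.
rewrite distrC.
have : (fun l => peval (P l) x - peval (P k) x) @ \oo -->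
    lim ((fun l => peval (P l) x) @ \oo) - peval (P k) x.
  by apply: cvgB => //; exact: cvg_cst.
move=> /cvg_norm c; have <- := cvg_lim (@Rhausdorff R) c.
apply: limr_le; first exact: cvgP c.
by exists K => // l /= Kl; exact: hK.
Qed.

Lemma ulim_continuous P H B x : nbhs x B -> ulim P H B -> {for x, continuous H}.
Proof.
move=> nB h; apply/(@cvgrPdist_le _ _ _ (nbhs x)) => e e0.
have e3 : 0 < e / 3 by rewrite divr_gt0.
have [K hK] := h _ e3.
have cP0 : peval (P K) @ x --> peval (P K) x by exact: continuous_peval.
have cP := (@cvgrPdist_le _ _ _ (nbhs x) _ _ _).1 cP0 _ e3.
near=> z.
have Bz : B z by near: z; exact: nB.
have Pz : `|peval (P K) x - peval (P K) z| <= e / 3 by near: z; exact: cP.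
have := hK K z (leqnn K) Bz; have := hK K x (leqnn K) (nbhs_singleton nB).
move: Pz; rewrite !ler_norml => /andP[? ?] /andP[? ?] /andP[? ?].
by apply/andP; split; lra.
Unshelve. all: by end_near. Qed.

(** Two applications of the mean value theorem; they lose the factor 1/2 of Taylor's formula, which
    does not matter for passing to the limit. *)
Lemma poly_taylor2 (Q : mpol N R) i x (t M : R) :
  (forall s : R, `|s| <= `|t| ->
     `|peval (mdv i (mdv i Q)) (s *: delta_mx 0 i + x)| <= M) ->
  `|peval Q (t *: delta_mx 0 i + x) - peval Q x - t * peval (mdv i Q) x|
    <= M * t ^+ 2.
Proof.
move=> QM; pose e : 'rV[R]_N := delta_mx 0 i.
have d (S : mpol N R) (s : R) : is_derive s (1 : R)
    (fun s => peval S (s *: e + x)) (peval (mdv i S) (s *: e + x)).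
  rewrite -partial_peval; apply: is_derive_line.
  by have [] := is_derive_peval S (s *: e + x) e.
have E S : peval S (0 *: e + x) = peval S x by rewrite scale0r add0r.
have [c ct] := mean_value t (d Q); rewrite E => ->.
have [c' cc] := mean_value c (d (mdv i Q)); rewrite E => Ec.
rewrite [t * _]mulrC -mulrBl Ec !normrM.
have := QM c' (le_trans cc ct).
set m := `|peval _ _| => mM.
have t2 : `|t| ^+ 2 = t ^+ 2 by rewrite real_normK// num_real.
rewrite -t2 expr2 -mulrA; apply: ler_pM => //.
  exact: normr_ge0.
by rewrite ler_wpM2r.
Qed.

(** The gradient estimate is linear in the bound, so it applies to the harmonic differences
    [P k - P l]. *)
Lemma ucauchy_mdv (N0 : (0 < N)%N) P y s i : 0 < s -> (forall k, plap (P k) = 0) ->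
  ucauchy P (cball y s) -> ucauchy (fun k => mdv i (P k)) (cball y (s / 4)).
Proof.
move=> s0 hP cP e e0; pose C := grad_const (N := N) s + 1.
have C1 : 0 < C by rewrite ltr_wpDl// sqrtr_ge0.
have [K hK] := cP (e / C) (divr_gt0 e0 C1).
exists K => k l x Kk Kl xs.
rewrite -pevalB -mpoly.mderivB.
have hB : plap (P k - P l) = 0 by rewrite plapB !hP subrr.
have hb z : cball y s z -> `|peval (P k - P l) z| <= e / C.
  by move=> zs; rewrite pevalB; exact: hK.
apply: le_trans (harmonic_grad_le N0 i s0 hB hb xs) _.
rewrite mulrA ler_pdivrMr// mulrC ler_wpM2l ?ltW//.
by rewrite /C ltrDl.
Qed.

Lemma ucauchy_bounded P y s : ucauchy P (cball y s) ->
  exists K M, forall k x, (K <= k)%N -> cball y s x -> `|peval (P k) x| <= M.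
Proof.
move=> /(_ 1 ltr01)[K hK].
have /compact_bounded[M [Mr hM]] : compact (peval (P K) @` cball y s).
  apply: continuous_compact; last exact: compact_cball.
  by apply: continuous_subspaceT; exact: continuous_peval.
exists K, (M + 1 + 1) => k x Kk xs.
have := hM (M + 1); rewrite ltrDl ltr01 => /(_ isT).
have im : (peval (P K) @` cball y s) (peval (P K) x) by exists x.
move=> /(_ _ im) /= h; have := hK k K x Kk (leqnn K) xs.
have := ler_normD (peval (P k) x - peval (P K) x) (peval (P K) x).
by rewrite subrK; lra.
Qed.

(** The second derivatives of the [P k] are eventually bounded on a smaller ball, so the quadratic
    Taylor remainder is uniform in [k] and survives in the limit. *)
Lemma ulim_derivable (N0 : (0 < N)%N) P H V y s x i : 0 < s ->
  (forall k, plap (P k) = 0) ->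
  ulim P H (cball y s) -> ulim (fun k => mdv i (P k)) V (cball y (s / 4)) ->
  dball y (s / 4 / 4) x ->
  derivable H x (delta_mx 0 i) /\ partial i H x = V x.
Proof.
move=> s0 hP PH PV xs.
have s4 : 0 < s / 4 by rewrite divr_gt0.
have sub1 : cball y (s / 4) `<=` cball y s.
  by move=> z /le_trans; apply; rewrite ler_pdivrMr// ler_pMr// ler1n.
have sub2 : cball y (s / 4 / 4) `<=` cball y (s / 4).
  by move=> z /le_trans; apply; rewrite ler_pdivrMr// ler_pMr// ler1n.
have hP' k : plap (mdv i (P k)) = 0 by rewrite plap_mdv hP mpoly.mderiv0.
have [K [M hM]] := ucauchy_bounded
  (ucauchy_mdv N0 i s4 hP' (ulim_ucauchy PV)).
have /nbhs_ballP[r /= r0 rA] : nbhs x (dball y (s / 4 / 4)).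
  by apply: open_nbhs_nbhs; split => //; exact: open_dball.
pose e : 'rV[R]_N := delta_mx 0 i.
have lA (t : R) : `|t| < r -> cball y (s / 4 / 4) (t *: e + x).
  move=> tr; apply: dball_cball; apply: rA.
  rewrite -ball_normE /= opprD addrCA subrr addr0 normrN.
  apply: le_lt_trans tr; apply: normr_rV_le => // j; rewrite !mxE.
  by case: (_ && _); rewrite ?mulr1 ?mulr0 ?normr0.
have M0 : 0 <= M.
  by apply: le_trans (normr_ge0 _) (hM K x (leqnn K) _); exact: dball_cball.
have key (t : R) : `|t| < r -> `|H (t *: e + x) - H x - t * V x| <= M * t ^+ 2.
  (* Replacing [H] at two points and [t * V x] by their approximations costs 2 d' + |t| d' = d. *)
  move=> tr; apply/ler_addgt0Pr => d d0; pose d' := d / (2 + `|t|).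
  have t2 : 0 < 2 + `|t| by rewrite ltr_wpDr.
  have d'0 : 0 < d' by rewrite divr_gt0.
  have [K1 h1] := PH d' d'0; have [K2 h2] := PV d' d'0.
  pose k := maxn K (maxn K1 K2).
  have kK : (K <= k)%N by rewrite leq_maxl.
  have kK1 : (K1 <= k)%N by rewrite /k !leq_max leqnn orbT.
  have kK2 : (K2 <= k)%N by rewrite /k !leq_max leqnn !orbT.
  have := h1 k _ kK1 (sub1 _ (sub2 _ (lA t tr))).
  have := h1 k x kK1 (sub1 _ (sub2 _ (dball_cball xs))).
  have := h2 k x kK2 (sub2 _ (dball_cball xs)).
  have := @poly_taylor2 (P k) i x t M; rewrite -/e => T.
  have {}T := T (fun q qt => hM k _ kK (lA q (le_lt_trans qt tr))).
  move: T; move: (peval (P k) (t *: e + x)) (peval (P k) x) => p1 p0.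
  move: (peval (mdv i (P k)) x) => pv T T2 T0 T1.
  have -> : H (t *: e + x) - H x - t * V x =
    (p1 - p0 - t * pv) - (p1 - H (t *: e + x)) + (p0 - H x) + t * (pv - V x) by ring.
  have dE : d = d' + d' + `|t| * d'.
    by rewrite /d'; field; rewrite gt_eqF.
  have -> : M * t ^+ 2 + d = M * t ^+ 2 + d' + d' + `|t| * d'.
    by rewrite [in LHS]dE; ring.
  apply: le_trans (ler_normD _ _) _; apply: lerD; last first.
    by rewrite normrM ler_wpM2l.
  apply: le_trans (ler_normD _ _) _; apply: lerD => //.
  by apply: le_trans (ler_normB _ _) _; apply: lerD.
have c : (fun h : R => h^-1 *: ((H \o shift x) (h *: e) - H x)) @ 0^' --> V x.
  apply/cvgrPdist_le => d d0.
  have M1 : 0 < M + 1 by rewrite ltr_wpDl.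
  near=> h.
  have h0 : h != 0 by near: h; exact: nbhs_dnbhs_neq.
  have hr : `|h| < r.
    near: h; apply: dnbhs0_lt; exact: r0.
  have hd : `|h| < d / (M + 1).
    by near: h; apply: dnbhs0_lt; rewrite divr_gt0.
  rewrite /= -[_ *: _]/(_ * _).
  have -> : V x - h^-1 * (H (h *: e + x) - H x) =
      - h^-1 * (H (h *: e + x) - H x - h * V x) by field.
  rewrite normrM normrN normfV mulrC ler_pdivrMr ?normr_gt0//.
  apply: le_trans (key h hr) _.
  rewrite -[h ^+ 2]real_normK ?num_real// expr2 mulrA ler_wpM2r//.
  apply: le_trans (_ : (M + 1) * `|h| <= _); first by rewrite ler_wpM2r// lerDl.
  by rewrite mulrC -ler_pdivlMr// ltW.
by split; [exact: cvgP c|exact: cvg_lim c].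
Unshelve. all: by end_near. Qed.

(** First and second derivatives converge too, on balls whose squared radius shrinks by 4 at each
    use of the gradient estimate. The loss is harmless because the argument is recentred at every
    point of the ball. *)
Lemma ulim_harmonic (N0 : (0 < N)%N) P H y s : 0 < s ->
  (forall k, plap (P k) = 0) -> ulim P H (cball y s) ->
  C2_on (dball y s) H /\ forall x, dball y s x -> laplacian H x = 0.
Proof.
move=> s00 hP PH00.
suff loc x : dball y s x -> exists r, [/\ 0 < r, C2_on (dball x r) H &
    laplacian H x = 0].
  split=> [x /loc[r [r0 HC _]]|x /loc[r []]//].
  by apply: HC; exact: dball_center.
move=> xs; have /nbhs_cball[r r0 rs] : nbhs x (dball y s).
  by apply: open_nbhs_nbhs; split => //; exact: open_dball.
have PH : ulim P H (cball x r) by apply: ulimS PH00 => z /rs /dball_cball.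
have r4 : 0 < r / 4 by rewrite divr_gt0.
have r16 : 0 < r / 4 / 4 by rewrite divr_gt0.
have r64 : 0 < r / 4 / 4 / 4 by rewrite divr_gt0.
have sub1 : cball x (r / 4) `<=` cball x r.
  by move=> z /le_trans; apply; rewrite ler_pdivrMr// ler_pMr// ler1n.
have sub2 : cball x (r / 4 / 4) `<=` cball x (r / 4).
  by move=> z /le_trans; apply; rewrite ler_pdivrMr// ler_pMr// ler1n.
have sub3 : cball x (r / 4 / 4 / 4) `<=` cball x (r / 4 / 4).
  by move=> z /le_trans; apply; rewrite ler_pdivrMr// ler_pMr// ler1n.
have lt3 : dball x (r / 4 / 4 / 4) `<=` dball x (r / 4 / 4).
  by move=> z /lt_le_trans; apply; rewrite ler_pdivrMr// ler_pMr// ler1n.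
have nb t z : dball x t z -> nbhs z (dball x t).
  by move=> zt; apply: open_nbhs_nbhs; split => //; exact: open_dball.
have hP' i k : plap (mdv i (P k)) = 0 by rewrite plap_mdv hP mpoly.mderiv0.
have /choice[V PV] i : exists V, ulim (fun k => mdv i (P k)) V (cball x (r / 4)).
  by apply: ucauchy_ulim; apply: ucauchy_mdv => //; exact: ulim_ucauchy PH.
have /choice[W PW] ij : exists W,
    ulim (fun k => mdv ij.2 (mdv ij.1 (P k))) W (cball x (r / 4 / 4)).
  by apply: ucauchy_ulim; apply: ucauchy_mdv => //; exact: ulim_ucauchy (PV _).
have dH i z (zs : dball x (r / 4 / 4) z) :=
  ulim_derivable N0 r0 hP PH (PV i) zs.
have dV i j z (zs : dball x (r / 4 / 4 / 4) z) :=
  ulim_derivable N0 r4 (hP' i) (PV i) (PW (i, j)) zs.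
have nV i z : dball x (r / 4 / 4 / 4) z -> \near z, V i z = partial i H z.
  move=> /lt3/nb; apply: filterS => q qs.
  by have [_ ->] := dH i q qs.
have nW i j z : dball x (r / 4 / 4 / 4) z ->
    \near z, W (i, j) z = partial j (partial i H) z.
  move=> zs; apply: filterS (nb _ _ zs) => q qs.
  have [_ <-] := dV i j q qs; apply: near_eq_partial.
  exact: nV.
exists (r / 4 / 4 / 4); split=> //.
- move=> z zs; have zn := nb _ _ zs; split.
  + by apply: ulim_continuous PH; apply: filterS zn => q /dball_cball/sub3/sub2/sub1.
  + move=> i; have [d _] := dH i z (lt3 _ zs); split => //.
    apply: (near_eq_continuous (nV i z zs)).
    by apply: ulim_continuous (PV i); apply: filterS zn => q /dball_cball/sub3/sub2.
  + move=> i j; have [d _] := dV i j z zs; split.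
      by apply: near_eq_derivable d; exact: nV.
    apply: (near_eq_continuous (nW i j z zs)).
    by apply: ulim_continuous (PW (i, j)); apply: filterS zn => q /dball_cball/sub3.
- have xx : dball x (r / 4 / 4 / 4) x by exact: dball_center.
  have -> : laplacian H x = \sum_i W (i, i) x.
    by apply: eq_bigr => i _; rewrite (nbhs_singleton (nW i i x xx)).
  apply/eqP; rewrite -normr_le0; apply/ler_addgt0Pr => e e0; rewrite add0r.
  have n0 : 0 < N%:R :> R by rewrite ltr0n.
  have /choice[K hK] i := PW (i, i) (e / N%:R) (divr_gt0 e0 n0).
  pose k := \max_i K i.
  (* The diagonal second derivatives of [P k] sum to zero, so only the approximation errors remain,
     each at most [e / N%:R]. *)
  have -> : \sum_i W (i, i) x =
      - \sum_i (peval (mdv i (mdv i (P k))) x - W (i, i) x).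
    have := hP k => /(congr1 (fun p => peval p x)); rewrite peval_sum peval0.
    by move=> E; rewrite sumrB E sub0r opprK.
  rewrite normrN; apply: le_trans (ler_norm_sum _ _ _) _.
  have -> : e = \sum_(i < N) e / N%:R.
    by rewrite sumr_const card_ord -[RHS]mulr_natr divfK// gt_eqF.
  apply: ler_sum => i _; apply: (hK i) => //; first exact: leq_bigmax.
  by apply: sub3; exact: dball_cball.
Qed.

End HarmonicLimits.

(** * Degree bounds and the Dirichlet problem for polynomials *)

Section Degree.
Context {R : realType} {N : nat}.
Implicit Types (P Q : mpol N R) (x y : 'rV[R]_N) (i j : 'I_N).

Definition degle P d := (mpoly.msize P <= d.+1)%N.

Lemma degleP P d :
  reflect (forall m, mpoly.mcoeff m P != 0 -> (mpoly.mdeg m <= d)%N) (degle P d).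
Proof.
apply: (iffP idP) => [Pd m|Pd].
  by rewrite -mpoly.mcoeff_msupp => /mpoly.msize_mdeg_lt/leq_trans/(_ Pd).
rewrite /degle mpoly.msizeE; apply/bigmax_leqP_seq => m mP _.
by rewrite ltnS Pd// -mpoly.mcoeff_msupp.
Qed.

Lemma degleW P d e : (d <= e)%N -> degle P d -> degle P e.
Proof. by move=> de /leq_trans; apply. Qed.

Lemma degle0 d : degle (0 : mpol N R) d.
Proof. by rewrite /degle mpoly.mmeasure0. Qed.

Lemma degleC c d : degle (mpoly.mpolyC N (c : R)) d.
Proof. by rewrite /degle mpoly.mmeasureC; case: (c != 0). Qed.

Lemma degleX i : degle (mvar i : mpol N R) 1.
Proof. by rewrite /degle mpoly.msizeX mpoly.mdeg1. Qed.

Lemma degleD P Q d : degle P d -> degle Q d -> degle (P + Q) d.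
Proof.
move=> Pd Qd; apply: leq_trans (mpoly.msizeD_le _ _) _.
by rewrite geq_max; apply/andP.
Qed.

Lemma degleN P d : degle P d -> degle (- P) d.
Proof. by rewrite /degle mpoly.mmeasureN. Qed.

Lemma degle_sum (I : Type) (r : seq I) (p : pred I) (F : I -> mpol N R) d :
  (forall k, p k -> degle (F k) d) -> degle (\sum_(k <- r | p k) F k) d.
Proof.
by move=> Fd; apply: (big_ind (fun P => degle P d)) => //;
  [exact: degle0|move=> P Q; exact: degleD].
Qed.

Lemma degleM P Q d e : degle P d -> degle Q e -> degle (P * Q) (d + e).
Proof.
move=> Pd Qe; have [->|P0] := eqVneq P 0; first by rewrite mul0r degle0.
have [->|Q0] := eqVneq Q 0; first by rewrite mulr0 degle0.
rewrite /degle mpoly.msizeM//; move: Pd Qe; rewrite /degle.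
case: (mpoly.msize P) => [|a] Pa Qe; last by rewrite addSn /= -addnS leq_add.
by rewrite add0n (leq_trans (leq_pred _))// (leq_trans Qe)// ltnS leq_addl.
Qed.

Lemma degle_mdv P d i : degle P d -> degle (mdv i P) d.-1.
Proof.
move=> /degleP Pd; apply/degleP => m; rewrite mpoly.mcoeff_deriv mulrn_eq0 /=.
by move=> /Pd; rewrite mpoly.mdegD mpoly.mdeg1 addn1; case: d {Pd}.
Qed.

Lemma mdv_degle0 P i : degle P 0 -> mdv i P = 0.
Proof. by move=> /mpoly.msize1_polyC ->; rewrite mpoly.mderivC. Qed.

Lemma degle_plap P d : degle P d -> degle (plap P) d.-2.
Proof. by move=> Pd; apply: degle_sum => i _; do 2!apply: degle_mdv. Qed.

Lemma plap_degle1 P : degle P 1 -> plap P = 0.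
Proof.
by move=> P1; apply: big1 => i _; rewrite (mdv_degle0 i (degle_mdv i P1)).
Qed.

Lemma degle_sqdist y : degle (sqdist y) 2.
Proof.
apply: degle_sum => i _; apply: (@degleM _ _ 1 1);
  by apply: degleD; [exact: degleX|apply: degleN; exact: degleC].
Qed.

(** By induction on the size, all formal partial derivatives vanish; in characteristic 0 this leaves
    a constant, whose value at [y] is 0. *)
Lemma peval_near_eq0 Q y : (\forall x \near y, peval Q x = 0) -> Q = 0.
Proof.
move: {2}(mpoly.msize Q) (leqnn (mpoly.msize Q)) => d.
elim: d Q => [|d IHd] Q Qd Q0.
  by apply/eqP; rewrite -(mpoly.msize_poly_eq0 Q) -leqn0.
have dQ i : mdv i Q = 0.
  apply: IHd.
    case: d Qd => [|d] Qd; last exact: (degle_mdv i Qd).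
    by rewrite mdv_degle0// mpoly.mmeasure0.
  rewrite -partial_peval.
  have : \forall x \near y, \forall z \near x, peval Q z = peval 0 z.
    by move: Q0 => /near_join; apply: filterS => x; apply: filterS => z ->; rewrite peval0.
  apply: filterS => x /near_eq_partial ->.
  by rewrite partial_peval mpoly.mderiv0 peval0.
have Q1 : degle Q 0.
  apply/degleP => m Qm; rewrite leqn0 mpoly.mdeg_eq0; apply/eqP/mpoly.mnmP => i.
  rewrite mpoly.mnm0E; apply/eqP; apply: contraNT Qm => mi.
  have /(congr1 (mpoly.mcoeff (mpoly.mnm_sub m (mpoly.mnm1 i)))) := dQ i.
  rewrite mpoly.mcoeff_deriv mpoly.mcoeff0 mpoly.submK; last by rewrite mpoly.lep1mP.
  by move=> /eqP; rewrite mulrn_eq0.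
have := nbhs_singleton Q0; rewrite (mpoly.msize1_polyC Q1) pevalC => ->.
exact: mpoly.mpolyC0.
Qed.

End Degree.

Section Fischer.
Context {R : realType} {N : nat}.
Implicit Types (P Q : mpol N R) (x y : 'rV[R]_N) (i j : 'I_N).

(** An injective endomorphism of a finite-dimensional space is onto. [psi] and [phi] are the
    coordinates in the basis of monomials of degree at most [d], and [M] is the matrix of [T],
    acting on row vectors. *)
Lemma degle_surj (T : mpol N R -> mpol N R) d :
  (forall c P Q, T (c *: P + Q) = c *: T P + T Q) ->
  (forall P, degle P d -> degle (T P) d) ->
  (forall P, degle P d -> T P = 0 -> P = 0) ->
  forall P, degle P d -> exists2 Q, degle Q d & T Q = P.
Proof.
move=> Tlin Td Tinj P Pd.
pose I : finType := mpoly.bmultinom N d.+1.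
pose X (m : I) : mpol N R := mpoly.mpolyX R m.
pose psi P : 'rV[R]_#|I| := \row_j mpoly.mcoeff (enum_val j : I) P.
pose phi (r : 'rV[R]_#|I|) : mpol N R := \sum_j r 0 j *: X (enum_val j).
have T0 : T 0 = 0.
  by have := Tlin (-1) 0 0; rewrite scaler0 addr0 scaleN1r addNr.
have Tsum (r : 'rV[R]_#|I|) : T (phi r) = \sum_j r 0 j *: T (X (enum_val j)).
  apply: (big_ind2 (fun P Q => T P = Q)) => // [P1 Q1 P2 Q2 E1 E2|j _].
    by have := Tlin 1 P1 P2; rewrite !scale1r E1 E2.
  by have := Tlin (r 0 j) (X (enum_val j)) 0; rewrite T0 !addr0.
have phid r : degle (phi r) d.
  apply: degle_sum => j _; rewrite /degle.
  by rewrite (leq_trans (mpoly.msizeZ_le _ _))// mpoly.msizeX mpoly.bmdeg.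
have phiK Q : degle Q d -> phi (psi Q) = Q.
  move=> Qd; rewrite [RHS](mpoly.mpolywE Qd) /phi.
  rewrite (reindex (@enum_val _ (mem I)))/=; last exact/onW_bij/enum_val_bij.
  by apply: eq_bigr => j _; rewrite mxE.
have psiK r : psi (phi r) = r.
  apply/rowP => j; rewrite mxE /phi raddf_sum /= (bigD1 j)//= big1 => [|k kj].
    by rewrite addr0 mpoly.mcoeffZ mpoly.mcoeffX eqxx mulr1.
  rewrite mpoly.mcoeffZ mpoly.mcoeffX; case: eqP => [/val_inj/enum_val_inj E|].
    by rewrite E eqxx in kj.
  by rewrite mulr0.
pose M := \matrix_(j < #|I|) psi (T (X (enum_val j))).
have ME r : r *m M = psi (T (phi r)).
  rewrite mulmx_sum_row Tsum; apply/rowP => k; rewrite summxE mxE raddf_sum /=.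
  by apply: eq_bigr => j _; rewrite !mxE mpoly.mcoeffZ.
have Mu : M \in unitmx.
  rewrite -row_free_unit; apply: inj_row_free => r; rewrite ME => E.
  have Tr : T (phi r) = 0.
    rewrite -(phiK _ (Td _ (phid r))) E /phi big1// => j _.
    by rewrite mxE scale0r.
  by rewrite -[r]psiK (Tinj _ (phid r) Tr); apply/rowP => j; rewrite !mxE mpoly.mcoeff0.
exists (phi (psi P *m invmx M)) => //.
by rewrite -(phiK _ (Td _ (phid _))) -ME mulmxKV// phiK.
Qed.

(* Fischer's argument: with [b] vanishing on the sphere, [Q |-> plap (b * Q)]
   is injective by the maximum principle, hence surjective by dimension. *)
Lemma poly_dirichlet (N0 : (0 < N)%N) y s P : 0 < s ->
  exists2 Q, plap Q = 0 & forall x, peval (sqdist y) x = s -> peval Q x = peval P x.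
Proof.
move=> s0; pose b := mpoly.mpolyC N s - sqdist y.
have bE x : peval b x = s - peval (sqdist y) x by rewrite /b pevalB pevalC.
have bd : degle b 2.
  by apply: degleD; [exact: degleC|apply: degleN; exact: degle_sqdist].
pose d := mpoly.msize P.
have Pd : degle P d by rewrite /degle /d.
have [] := @degle_surj (fun Q => plap (b * Q)) d _ _ _ (plap P).
- by move=> c P1 P2; rewrite mulrDr -scalerAr plapD plapZ.
- by move=> Q Qd; have := degle_plap (degleM bd Qd).
(* [b * Q] is harmonic and zero on the sphere, hence zero in the ball; there [b > 0], so [Q]
   vanishes near [y]. *)
- move=> Q _ hQ; apply: (@peval_near_eq0 _ _ _ y).
  have bQ0 x : cball y s x -> peval (b * Q) x = 0.
    have le0 S : plap (b * S) = 0 -> forall x, cball y s x -> peval (b * S) x <= 0.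
      move=> hS {}x; apply: (max_principle N0 s0) => z; rewrite ?hS ?peval0//.
      by move=> zs; rewrite pevalM bE zs subrr mul0r.
    move=> xs; apply/eqP; rewrite eq_le le0//= -oppr_le0 -pevalN -mulrN le0//.
    by rewrite mulrN plapN hQ oppr0.
  have : nbhs y (dball y s).
    by apply: open_nbhs_nbhs; split; [exact: open_dball|exact: dball_center].
  apply: filterS => x xs; have /eqP := bQ0 x (dball_cball xs).
  rewrite pevalM mulf_eq0 => /orP[|/eqP//].
  by rewrite bE subr_eq0 gt_eqF.
- by apply: degleW (degle_plap Pd); rewrite -subn2 leq_subr.
(* Subtracting a multiple of [b] removes the Laplacian of [P] and leaves its boundary values
   unchanged. *)
move=> Q _ hQ; exists (P - b * Q); first by rewrite plapB hQ subrr.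
by move=> x xs; rewrite pevalB pevalM bE xs subrr mul0r subr0.
Qed.

End Fischer.

(** * Bernstein approximation and the Dirichlet problem in a ball *)

Section Bernoulli.
Context {R : realType} {I : finType} (t : I -> R).

(* Independent Bernoulli variables [a p] of parameters [t p]: [bweight a] is the
   probability of the outcome [a]. *)
Definition bweight (a : {ffun I -> bool}) : R :=
  \prod_p (if a p then t p else 1 - t p).

(** Independence: the expectation of a product of functions of distinct trials factorizes. *)
Lemma bweight_prod (F : I -> bool -> R) :
  \sum_a bweight a * \prod_p F p (a p) =
  \prod_p (t p * F p true + (1 - t p) * F p false).
Proof.
rewrite (eq_bigr (fun p => \sum_(b : bool) (if b then t p else 1 - t p) * F p b)).
  by rewrite bigA_distr_bigA; apply: eq_bigr => a _; rewrite -big_split.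
by move=> p _; rewrite big_bool.
Qed.

Lemma bweight_sum : \sum_a bweight a = 1.
Proof.
have := bweight_prod (fun _ _ => 1).
rewrite [RHS]big1 => [<-|p _]; last by rewrite !mulr1 addrC subrK.
by apply: eq_bigr => a _; rewrite big1// mulr1.
Qed.

Lemma bweight_cov p q :
  \sum_a bweight a * (((a p)%:R - t p) * ((a q)%:R - t q)) =
  if p == q then t p * (1 - t p) else 0.
Proof.
(* Factors equal to 1 away from [p] and [q] put the mixed moment in product form; when [p = q] both
   deviations fall on the same trial and give its variance. *)
pose F r (b : bool) : R := (if r == p then b%:R - t r else 1) *
  (if r == q then b%:R - t r else 1).
have FE (a : {ffun I -> bool}) :
    \prod_r F r (a r) = ((a p)%:R - t p) * ((a q)%:R - t q).
  by rewrite big_split/= -!big_mkcond /= !big_pred1_eq.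
rewrite -(eq_bigr _ (fun a _ => congr1 (fun z => bweight a * z) (FE a))).
rewrite bweight_prod (bigD1 p)//= /F eqxx; case: eqVneq => [<-|pq].
  by rewrite big1 => [|r /negbTE ->]; rewrite /= ?mulr1n ?mulr0n; ring.
by rewrite !mulr1 [X in X * _](_ : _ = 0) ?mul0r//= mulr1n mulr0n; ring.
Qed.

Lemma bweight_ge0 a : (forall p, 0 <= t p <= 1) -> 0 <= bweight a.
Proof.
move=> t01; apply: prodr_ge0 => p _; have /andP[? ?] := t01 p.
by case: (a p) => //; rewrite subr_ge0.
Qed.

(** The covariances of distinct trials vanish; [f] selects the trials attached to one coordinate. *)
Lemma bweight_var (J : finType) (f : J -> I) : injective f ->
  \sum_a bweight a * (\sum_j ((a (f j))%:R - t (f j))) ^+ 2 =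
  \sum_j t (f j) * (1 - t (f j)).
Proof.
move=> finj.
rewrite (eq_bigr (fun a => \sum_j \sum_k
    bweight a * (((a (f j))%:R - t (f j)) * ((a (f k))%:R - t (f k))))); last first.
  move=> a _; rewrite expr2 big_distrlr mulr_sumr; apply: eq_bigr => j _.
  by rewrite mulr_sumr.
rewrite exchange_big; apply: eq_bigr => j _.
rewrite exchange_big /= (bigD1 j)//= bweight_cov eqxx big1 ?addr0// => k kj.
by rewrite bweight_cov (inj_eq finj) eq_sym (negbTE kj).
Qed.

End Bernoulli.

Section Weierstrass.
Context {R : realType} {N : nat}.
Implicit Types (x y z : 'rV[R]_N) (G : 'rV[R]_N -> R).

(** The approximant at [x] is the expectation of [G] at a random grid point of a cube around the
    ball: each coordinate is the success rate of [k] trials whose parameter is the rescaled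
    coordinate of [x]. For Lipschitz [G], the variance of the success rates bounds the error. *)
Lemma bernstein_approx G (L : R) y s : 0 < s -> 0 <= L ->
  (forall x z, `|G x - G z| <= L * `|x - z|) ->
  forall e : R, 0 < e ->
  exists P : mpol N R, forall x, cball y s x -> `|peval P x - G x| <= e.
Proof.
move=> s0 L0 GL e e0.
(* The cube of half-side [rho] contains the ball, so that the parameters [t p] lie in [0, 1]. *)
pose rho := s + 1; have rho0 : 0 < rho by rewrite addr_gt0.
pose C := L * (2 * rho) * N%:R; have C0 : 0 <= C.
  by rewrite mulr_ge0// mulr_ge0// mulr_ge0// ltW.
have C1 : 0 < C + 1 by rewrite ltr_wpDl.
(* The total error will be 2 C eta; the added 1 covers C = 0. *)
have [eta eta0 etaE] : exists2 eta, 0 < eta & eta = e / (2 * (C + 1)).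
  by exists (e / (2 * (C + 1))) => //; apply: divr_gt0 => //; exact: mulr_gt0.
(* The mean of the squared deviation sum is at most [k]; divided by eta k^2 it is at most 1 / (eta
   k), hence at most [eta]. *)
pose k := (Num.truncn (eta ^- 2)).+1.
have k0 : 0 < k%:R :> R by rewrite ltr0n.
have keta : (eta * k%:R)^-1 <= eta.
  rewrite -[leLHS]mul1r ler_pdivrMr ?mulr_gt0//.
  have : eta ^- 2 * eta ^+ 2 <= k%:R * eta ^+ 2.
    by rewrite ler_wpM2r ?sqr_ge0// ltW// truncnS_gt.
  by rewrite mulVf ?expf_neq0 ?gt_eqF// => /le_trans; apply; rewrite mulrC expr2 mulrA.
pose I := ('I_N * 'I_k)%type.
pose T (i : 'I_N) : mpol N R :=
  (2 * rho)^-1 *: (mvar i - mpoly.mpolyC N (y 0 i - rho)).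
pose node (a : {ffun I -> bool}) : 'rV[R]_N :=
  \row_i (y 0 i - rho + 2 * rho * ((\sum_l (a (i, l))%:R) / k%:R)).
pose P : mpol N R := \sum_a mpoly.mpolyC N (G (node a)) *
  \prod_(p : I) (if a p then T p.1 else 1 - T p.1).
exists P => x xs.
pose t (p : I) : R := peval (T p.1) x.
have tE i : peval (T i) x = (x 0 i - (y 0 i - rho)) / (2 * rho).
  by rewrite /T pevalZ pevalB pevalX pevalC mulrC.
have t01 p : 0 <= t p <= 1.
  have rr : 0 < 2 * rho by rewrite mulr_gt0.
  have h := le_trans (sqdist_coord y x p.1) xs.
  rewrite /t tE ler_pdivlMr// mul0r ler_pdivrMr// mul1r.
  move: h (sqr_ge0 (x 0 p.1 - y 0 p.1 - 1)) (sqr_ge0 (x 0 p.1 - y 0 p.1 + 1)).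
  by rewrite /rho => ? ? ?; apply/andP; split; nra.
have -> : peval P x = \sum_a bweight t a * G (node a).
  rewrite peval_sum; apply: eq_bigr => a _; rewrite pevalM pevalC mulrC; congr (_ * _).
  rewrite (big_morph (fun P => peval P x) (fun P Q => pevalM P Q x) (mpoly.meval1 _)).
  apply: eq_bigr => p _; case: (a p) => //.
  by rewrite pevalB -(mpoly.mpolyC1 N R) pevalC.
rewrite -[G x]mul1r -(bweight_sum t) mulr_suml -sumrB.
rewrite (eq_bigr (fun a => bweight t a * (G (node a) - G x))); last first.
  by move=> a _; rewrite mulrBr.
apply: le_trans (ler_norm_sum _ _ _) _.
pose dev i (a : {ffun I -> bool}) := \sum_(l < k) ((a (i, l))%:R - t (i, l)).
have devE i a : node a 0 i - x 0 i = 2 * rho * (dev i a / k%:R).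
  have -> : dev i a = \sum_l (a (i, l))%:R - k%:R * peval (T i) x.
    rewrite /dev sumrB [X in _ - X](eq_bigr (fun=> peval (T i) x))//.
    by rewrite sumr_const card_ord mulr_natl.
  rewrite mxE tE; move: (\sum_l _) => S.
  by field; rewrite !gt_eqF.
have key a : `|bweight t a * (G (node a) - G x)| <= L * (2 * rho) *
    \sum_i (bweight t a * eta + bweight t a * dev i a ^+ 2 / (eta * k%:R ^+ 2)).
  rewrite normrM ger0_norm ?bweight_ge0//.
  apply: le_trans (ler_wpM2l (bweight_ge0 _ t01) (GL _ _)) _.
  rewrite mulrCA -mulrA ler_wpM2l// mulr_sumr.
  have -> : \sum_i 2 * rho * (bweight t a * eta + bweight t a * dev i a ^+ 2 /
      (eta * k%:R ^+ 2)) = bweight t a *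
      \sum_i 2 * rho * (eta + dev i a ^+ 2 / (eta * k%:R ^+ 2)).
    by rewrite mulr_sumr; apply: eq_bigr => i _; ring.
  apply: ler_wpM2l; first exact: bweight_ge0.
  have term0 i : 0 <= 2 * rho * (eta + dev i a ^+ 2 / (eta * k%:R ^+ 2)).
    rewrite mulr_ge0 ?mulr_ge0 ?ltW// ltr_pwDl// divr_ge0 ?sqr_ge0//.
    by rewrite mulr_ge0 ?exprn_ge0 ?ltW.
  apply: normr_rV_le => [|i]; first by rewrite sumr_ge0.
  rewrite (bigD1 i)//= ler_wpDr ?sumr_ge0//.
  have -> : (node a - x) 0 i = node a 0 i - x 0 i.
    by rewrite [LHS]mxE [X in _ + X]mxE.
  rewrite devE normrM gtr0_norm ?mulr_gt0// ler_pM2l ?mulr_gt0//.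
  rewrite normrM normfV (gtr0_norm k0) -[X in _ <= _ + X / _]real_normK ?num_real//.
  set D := `|dev i a|.
  (* This square bounds the first moment by the second and does the work of Chebyshev's
     inequality. *)
  have : 0 <= (eta - D / k%:R) ^+ 2 / eta by rewrite divr_ge0 ?sqr_ge0 ?ltW.
  have -> : (eta - D / k%:R) ^+ 2 / eta =
      eta + D ^+ 2 / (eta * k%:R ^+ 2) - 2 * (D / k%:R).
    by field; rewrite !gt_eqF.
  have : 0 <= D / k%:R by apply: divr_ge0; [exact: normr_ge0|exact: ltW].
  lra.
apply: le_trans (ler_sum _ (fun a _ => key a)) _.
rewrite -mulr_sumr exchange_big /=.
have var_le i : \sum_a (bweight t a * eta +
    bweight t a * dev i a ^+ 2 / (eta * k%:R ^+ 2)) <= 2 * eta.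
  rewrite big_split /= -!mulr_suml bweight_sum mul1r mulr_natl mulr2n lerD2l.
  rewrite (bweight_var t (f := fun l => (i, l))) => [|l l' [] //].
  apply: le_trans keta.
  rewrite ler_pdivrMr ?mulr_gt0 ?exprn_gt0//.
  have -> : (eta * k%:R)^-1 * (eta * k%:R ^+ 2) = k%:R.
    by field; rewrite !gt_eqF.
  rewrite -[X in _ <= X%:R](card_ord k) -sumr_const ler_sum// => l _.
  by have /andP[? ?] := t01 (i, l); nra.
apply: le_trans (_ : L * (2 * rho) * \sum_(i < N) 2 * eta <= _).
  apply: ler_wpM2l; last by apply: ler_sum.
  by apply: mulr_ge0 => //; apply/ltW/mulr_gt0.
rewrite sumr_const card_ord -[2 * eta *+ N]mulr_natl.
have -> : L * (2 * rho) * (N%:R * (2 * eta)) = e * (C / (C + 1)).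
  by rewrite etaE -/C [LHS]mulrA -/C; field; rewrite gt_eqF.
by rewrite ler_piMr ?ltW// ltr_pdivrMr// mul1r ltrDl.
Qed.

End Weierstrass.

Section Dirichlet.
Context {R : realType} {N : nat}.
Implicit Types (x y z : 'rV[R]_N) (G H : 'rV[R]_N -> R).

Definition lip (L : R) G := 0 <= L /\ forall x z, `|G x - G z| <= L * `|x - z|.

Lemma lip_continuous L G : lip L G -> continuous G.
Proof.
move=> [L0 GL] x; apply/(@cvgrPdist_le _ _ _ (nbhs x)) => e e0.
have L1 : 0 < L + 1 by rewrite ltr_wpDl.
apply/nbhs_ballP; exists (e / (L + 1)) => [|z] /=; first exact: divr_gt0.
rewrite -ball_normE /= ltr_pdivlMr// => xz.
apply: le_trans (GL _ _) _; apply: le_trans (ltW xz).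
by rewrite mulrC ler_wpM2l// lerDl.
Qed.

(** The maximum principle turns uniform convergence of polynomial data on the sphere into uniform
    convergence of the solutions on the closed ball. [H] is extended by [G] so that it can compete
    as a supersolution on the whole space. *)
Lemma dirichlet_ball (N0 : (0 < N)%N) G L y s : 0 < s -> lip L G ->
  exists H, [/\ continuous H, forall x, ~ dball y s x -> H x = G x,
    C2_on (dball y s) H & forall x, dball y s x -> laplacian H x = 0].
Proof.
move=> s0 lG; have [L0 GL] := lG; have cG := lip_continuous lG.
have ik0 k : 0 < k.+1%:R^-1 :> R by rewrite invr_gt0 ltr0n.
have ik (e : R) : 0 < e -> exists K : nat, forall k, (K <= k)%N -> k.+1%:R^-1 <= e.
  move=> e0; exists (Num.truncn e^-1) => k Kk.
  rewrite -[leRHS]invrK lef_pV2 ?posrE ?invr_gt0 ?ltr0n//.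
  by apply: ltW; apply: lt_le_trans (truncnS_gt _) _; rewrite ler_nat.
have /choice[P PG] k : exists P : mpol N R,
    forall x, cball y s x -> `|peval P x - G x| <= k.+1%:R^-1.
  exact: bernstein_approx GL _ (ik0 k).
have /choice[Q QP] k : exists Q : mpol N R, plap Q = 0 /\
    forall x, peval (sqdist y) x = s -> peval Q x = peval (P k) x.
  by have [Q Q1 Q2] := poly_dirichlet N0 y (P k) s0; exists Q.
have hQ k : plap (Q k) = 0 by have [] := QP k.
have QG k x : peval (sqdist y) x = s -> `|peval (Q k) x - G x| <= k.+1%:R^-1.
  by move=> xs; have [_ ->//] := QP k; apply: PG; rewrite /cball /= xs.
have cQ : ucauchy Q (cball y s).
  move=> e e0; have [|K hK] := ik (e / 2); first by rewrite divr_gt0.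
  have le k l x : (K <= k)%N -> (K <= l)%N -> cball y s x ->
      peval (Q k) x - peval (Q l) x <= e.
    move=> Kk Kl; rewrite -pevalB; apply: (max_principle N0 s0) => {x}.
      by move=> x _; rewrite plapB !hQ subrr peval0.
    move=> x xs; rewrite pevalB; have := QG k x xs; have := QG l x xs.
    have := hK k Kk; have := hK l Kl.
    move: (k.+1%:R^-1) (l.+1%:R^-1) => a b.
    by rewrite !ler_norml => ? ? /andP[? ?] /andP[? ?]; lra.
  exists K => k l x Kk Kl xs; rewrite ler_norml le// andbT.
  by have := le l k x Kl Kk xs; lra.
have [H0 QH0] := ucauchy_ulim cQ.
have H0G x : peval (sqdist y) x = s -> H0 x = G x.
  move=> xs; apply/eqP; rewrite -subr_eq0 -normr_le0; apply/ler_addgt0Pr => e e0.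
  have e2 : 0 < e / 2 by rewrite divr_gt0.
  have [K1 h1] := QH0 _ e2; have [K2 h2] := ik _ e2.
  have xc : cball y s x by rewrite /cball /= xs.
  have := h1 _ x (leq_maxl K1 K2) xc; have := QG (maxn K1 K2) x xs.
  have := h2 _ (leq_maxr K1 K2).
  move: (_.+1%:R^-1) => a.
  by rewrite !ler_norml => ? /andP[? ?] /andP[? ?]; apply/andP; split; lra.
pose H x := if peval (sqdist y) x < s then H0 x else G x.
have HH0 x : cball y s x -> H x = H0 x.
  rewrite /cball /= le_eqVlt /H => /orP[/eqP xs|->//].
  by rewrite xs ltxx H0G.
have HG x : ~ dball y s x -> H x = G x.
  by rewrite /dball /= /H; case: ifP.
have nb x : dball y s x -> nbhs x (dball y s).
  by move=> xs; apply: open_nbhs_nbhs; split => //; exact: open_dball.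
have [C20 lap0] := ulim_harmonic N0 s0 hQ QH0.
have HE x : dball y s x -> H0 x = H x by move=> /dball_cball/HH0.
have [C2H lapH] := C2_on_near_eq (@open_dball _ _ y s) HE C20.
exists H; split; [|exact: HG|exact: C2H|by move=> x xs; rewrite lapH ?lap0].
move=> x; have [xs|xs] := pselect (dball y s x).
  by have [] := C2H x xs.
have [xc|xc] := pselect (cball y s x); last first.
  apply: (@near_eq_continuous _ _ G); last exact: cG.
  have : nbhs x (~` cball y s).
    by apply: open_nbhs_nbhs; split => //; apply: closed_openC; exact: closed_cball.
  by apply: filterS => z zc; rewrite HG// => /dball_cball.
(* At a point of the sphere, nearby points inside the ball are handled by one approximating
   polynomial and those outside by the continuity of [G]. *)
apply/(@cvgrPdist_le _ _ _ (nbhs x)) => e e0.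
have e3 : 0 < e / 3 by rewrite divr_gt0.
have [K hK] := QH0 _ e3.
have cP0 : peval (Q K) @ x --> peval (Q K) x by exact: continuous_peval.
have cP := (@cvgrPdist_le _ _ _ (nbhs x) _ _ _).1 cP0 _ e3.
have cGx : G @ x --> G x by exact: cG.
have cGe := (@cvgrPdist_le _ _ _ (nbhs x) _ _ _).1 cGx _ e0.
near=> z.
have [zc|zc] := pselect (cball y s z); last first.
  rewrite (HG x)// HG => [|/dball_cball//]; near: z; exact: cGe.
have Pz : `|peval (Q K) x - peval (Q K) z| <= e / 3 by near: z; exact: cP.
rewrite !HH0//; have := hK K z (leqnn K) zc; have := hK K x (leqnn K) xc.
move: Pz; rewrite !ler_norml => /andP[? ?] /andP[? ?] /andP[? ?].
by apply/andP; split; lra.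
Unshelve. all: by end_near. Qed.

End Dirichlet.

(** * Perron's method *)

Section AffineChange.
Context {R : realType} {N : nat}.
Implicit Types (u w phi : 'rV[R]_N -> R) (A : set 'rV[R]_N) (x z sg e : 'rV[R]_N).

Lemma derivable_opp_dir phi x (v : 'rV[R]_N) : derivable phi x v ->
  derivable phi x (- v) /\ 'D_(- v) phi x = - 'D_v phi x.
Proof.
move=> d.
have c : (fun h : R => h^-1 *: ((phi \o shift x) (h *: - v) - phi x)) @ 0^' -->
    - 'D_v phi x.
  have c0 : (fun h : R => h^-1 *: ((phi \o shift x) (h *: v) - phi x)) @ 0^' -->
    'D_v phi x by exact: d.
  apply/cvgrPdist_lt => e e0.
  have /cvgrPdist_lt/(_ e e0) := c0.
  move=> /nbhs_ballP[r /= r0 hr]; apply/nbhs_ballP; exists r => //= h hh h0.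
  have h1 : ball (0 : R) r (- h) by move: hh; rewrite /ball /= !sub0r !normrN.
  have h2 : - h != 0 by rewrite oppr_eq0.
  have := hr _ h1 h2; rewrite /= scalerN -scaleNr.
  move: (phi (- h *: v + x) - phi x) ('D_v phi x) => D d'.
  rewrite -[(- h)^-1 *: D]/((- h)^-1 * D) -[h^-1 *: D]/(h^-1 * D) invrN.
  have -> : - d' - h^-1 * D = - (d' - - h^-1 * D) by ring.
  by rewrite normrN.
by split; [exact: cvgP c|exact: cvg_lim c].
Qed.

(* [sg] is a vector of signs, so that these maps are reflections and translations. *)
Definition signed_shift (sg e : 'rV[R]_N) x : 'rV[R]_N :=
  \row_i (sg 0 i * x 0 i + e 0 i).

Lemma signed_shift_norm sg e x z : (forall i, sg 0 i ^+ 2 = 1) ->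
  `|signed_shift sg e x - signed_shift sg e z| <= `|x - z|.
Proof.
move=> sg1; apply: normr_rV_le => // i; rewrite !mxE.
have -> : sg 0 i * x 0 i + e 0 i - (sg 0 i * z 0 i + e 0 i) =
  sg 0 i * (x - z) 0 i by rewrite !mxE; ring.
have -> : `|sg 0 i * (x - z) 0 i| = `|(x - z) 0 i|.
  rewrite normrM; have /eqP := sg1 i; rewrite sqrf_eq1 => /orP[]/eqP->.
    by rewrite normr1 mul1r.
  by rewrite normrN1 mul1r.
exact: normr_coord.
Qed.

Lemma signed_shift_continuous sg e : (forall i, sg 0 i ^+ 2 = 1) ->
  continuous (signed_shift sg e).
Proof.
move=> sg1 x; apply/(@cvgrPdist_le _ _ _ (nbhs x)) => d d0.
apply/nbhs_ballP; exists d => // z; rewrite -ball_normE /= => xz.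
exact: le_trans (signed_shift_norm e x z sg1) (ltW xz).
Qed.

Lemma partial_signed_shift sg e phi x i : (forall i, sg 0 i ^+ 2 = 1) ->
  derivable phi (signed_shift sg e x) (delta_mx 0 i) ->
  derivable (phi \o signed_shift sg e) x (delta_mx 0 i) /\
  partial i (phi \o signed_shift sg e) x =
    sg 0 i * partial i phi (signed_shift sg e x).
Proof.
move=> sg1 d; pose T := signed_shift sg e; pose v : 'rV[R]_N := delta_mx 0 i.
have E : (fun h : R => h^-1 *: (((phi \o T) \o shift x) (h *: v) - (phi \o T) x)) =
  (fun h : R => h^-1 *: ((phi \o shift (T x)) (h *: (sg 0 i *: v)) - phi (T x))).
  apply/funext => h /=; congr (_ *: (phi _ - _)); apply/rowP => j; rewrite !mxE.
  by case: (eqVneq j i) => [->|ji]; rewrite !eqxx /=; ring.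
have [d1 d2] : derivable phi (T x) (sg 0 i *: v) /\
    'D_(sg 0 i *: v) phi (T x) = sg 0 i * partial i phi (T x).
  have /eqP := sg1 i; rewrite sqrf_eq1 => /orP[]/eqP->.
    by rewrite scale1r mul1r.
  by rewrite scaleN1r mulN1r; exact: derivable_opp_dir.
by split; [rewrite /derivable E|rewrite /partial /derive E].
Qed.

Lemma C2_on_signed_shift sg e A phi : (forall i, sg 0 i ^+ 2 = 1) -> open A ->
  C2_on A phi ->
  C2_on (signed_shift sg e @^-1` A) (phi \o signed_shift sg e) /\
  forall x, A (signed_shift sg e x) ->
    laplacian (phi \o signed_shift sg e) x = laplacian phi (signed_shift sg e x).
Proof.
move=> sg1 oA phiA; pose T := signed_shift sg e.
have cT : continuous T by exact: signed_shift_continuous.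
have oTA : open (T @^-1` A) by apply: open_comp => // x _; exact: cT.
have cpT w x : {for T x, continuous w} -> {for x, continuous (w \o T)}.
  by move=> cw; apply: continuous_comp => //; exact: cT.
have d1 i x : A (T x) -> derivable (phi \o T) x (delta_mx 0 i) /\
    partial i (phi \o T) x = sg 0 i * partial i phi (T x).
  by move=> /phiA[_ /(_ i)[d _] _]; exact: partial_signed_shift.
have nd1 i x : A (T x) ->
    \near x, sg 0 i * partial i phi (T x) = partial i (phi \o T) x.
  move=> Ax; have : nbhs x (T @^-1` A) by exact: open_nbhs_nbhs.
  by apply: filterS => z /(d1 i)[_ ->].
have clin c w x : {for x, continuous w} -> {for x, continuous (fun z => c * w z)}.
  by move=> cw; apply: continuousM => //; exact: cst_continuous.
have d2 i j x : A (T x) -> derivable (partial i (phi \o T)) x (delta_mx 0 j) /\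
    partial j (partial i (phi \o T)) x =
    sg 0 i * (sg 0 j * partial j (partial i phi) (T x)).
  move=> Ax; have [_ _ /(_ i j)[d _]] := phiA _ Ax.
  have [p1 p2] := partial_signed_shift sg1 d.
  have d0 : derivable (fun=> 0 : R) x (delta_mx 0 j) by exact: derivable_cst.
  have [q1 q2] := partial_lin (sg 0 i) p1 d0.
  have E : \near x, sg 0 i * (partial i phi \o T) x + 0 = partial i (phi \o T) x.
    by apply: filterS (nd1 i x Ax) => z <-; rewrite addr0.
  split; first by apply: near_eq_derivable q1; exact: E.
  rewrite -(near_eq_partial _ E) q2 p2 [X in _ + X](_ : _ = 0) ?addr0//.
  by rewrite /partial derive_cst.
have nd2 i j x : A (T x) -> \near x,
    sg 0 i * (sg 0 j * partial j (partial i phi) (T x)) =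
    partial j (partial i (phi \o T)) x.
  move=> Ax; have : nbhs x (T @^-1` A) by exact: open_nbhs_nbhs.
  by apply: filterS => z /(d2 i j)[_ ->].
split=> [x Ax|x Ax]; last first.
  apply: eq_bigr => i _; have [_ ->] := d2 i i x Ax.
  by rewrite mulrA -expr2 sg1 mul1r.
have [c0 c1 c2] := phiA _ Ax; split; first exact: cpT.
  move=> i; split; first by have [] := d1 i x Ax.
  apply: (near_eq_continuous (nd1 i x Ax)); apply: (clin); apply: (cpT).
  by have [] := c1 i.
move=> i j; split; first by have [] := d2 i j x Ax.
apply: (near_eq_continuous (nd2 i j x Ax)); do 2!apply: (clin); apply: cpT.
by have [] := c2 i j.
Qed.

(** Test functions are carried over by the inverse map, itself a signed shift; in the Laplacian
    every sign occurs squared. *)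
Lemma visc_signed_shift sg e w : (forall i, sg 0 i ^+ 2 = 1) ->
  viscosity_superharmonic w -> viscosity_superharmonic (w \o signed_shift sg e).
Proof.
move=> sg1 ws x0 A phi oA Ax0 phiA phix0 phile.
pose T := signed_shift sg e.
pose T' := signed_shift sg (\row_i - (sg 0 i * e 0 i)).
have TK x : T' (T x) = x.
  apply/rowP => i; rewrite !mxE.
  have -> : sg 0 i * (sg 0 i * x 0 i + e 0 i) - sg 0 i * e 0 i =
    sg 0 i ^+ 2 * x 0 i by ring.
  by rewrite sg1 mul1r.
have TK' x : T (T' x) = x.
  apply/rowP => i; rewrite !mxE.
  have -> : sg 0 i * (sg 0 i * x 0 i - sg 0 i * e 0 i) + e 0 i =
    sg 0 i ^+ 2 * x 0 i + (1 - sg 0 i ^+ 2) * e 0 i by ring.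
  by rewrite sg1 subrr mul0r addr0 mul1r.
have [C2' lap'] := C2_on_signed_shift (\row_i - (sg 0 i * e 0 i)) sg1 oA phiA.
have cT' : continuous T' by exact: signed_shift_continuous.
have oTA : open (T' @^-1` A) by apply: open_comp => // x _; exact: cT'.
have := ws (T x0) _ _ oTA _ C2'; rewrite lap' -/T' TK//.
apply; rewrite /= ?TK ?phix0// => x Ax.
by rewrite (le_trans (phile _ Ax))//= -/T TK'.
Qed.

End AffineChange.

Section Perron.
Context {R : realType} {N : nat}.
Implicit Types (u v w phi : 'rV[R]_N -> R) (A : set 'rV[R]_N) (x y z : 'rV[R]_N).

Lemma visc_super_onS A w : viscosity_superharmonic w -> visc_super_on A w.
Proof. by move=> ws x0 B phi oB Bx _; exact: ws oB Bx. Qed.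

Lemma visc_add_harmonic w (P : mpol N R) : plap P = 0 ->
  viscosity_superharmonic w ->
  viscosity_superharmonic (fun x => w x + peval P x).
Proof.
move=> hP ws x0 A phi oA Ax0 phiA phix0 phile.
have PA : C2_on A (peval (- P)) by exact: C2_on_peval.
have [C2' lap'] := C2_on_lin 1 oA phiA PA.
have := ws x0 _ _ oA Ax0 C2'; rewrite lap'// laplacian_peval plapN hP oppr0 peval0.
move=> H; have : 1 * laplacian phi x0 + 0 <= 0; last by rewrite addr0 mul1r.
apply: H => [|x /phile]; first by rewrite pevalN phix0; ring.
by rewrite pevalN; lra.
Qed.

(** Suppose [phi] touches [G] at [x0] with positive Laplacian. Lowered by eta |x - x0|^2, it stays
    strictly subharmonic in a small ball and lies eta s below [G] on the sphere. A member of [F]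
    within eta s of [G] at [x0] is then touched at an interior point, a contradiction; closeness at
    the single point [x0] suffices. *)
Lemma visc_inf (N0 : (0 < N)%N) (F : set ('rV[R]_N -> R)) G :
  (forall w, F w -> continuous w /\ viscosity_superharmonic w) ->
  (forall w x, F w -> G x <= w x) ->
  (forall x (e : R), 0 < e -> exists2 w, F w & w x < G x + e) ->
  viscosity_superharmonic G.
Proof.
move=> Fs GF Ginf x0 A phi oA Ax0 phiA phix0 phile; rewrite leNgt; apply/negP => c0.
set c := laplacian phi x0 in c0.
have n0 : 0 < N%:R :> R by rewrite ltr0n.
have [eta eta0 etaE] : exists2 eta, 0 < eta & eta * (2 * N%:R) = c / 2.
  exists (c / (4 * N%:R)); first by apply: divr_gt0 => //; exact: mulr_gt0.
  by field; rewrite gt_eqF.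
have lapc : {for x0, continuous (laplacian phi)}.
  have [_ _ d2] := phiA _ Ax0.
  have -> : laplacian phi = \sum_i partial i (partial i phi).
    by apply/funext => x; rewrite fct_sumE.
  apply: (big_ind (fun f : 'rV[R]_N -> R => {for x0, continuous f})).
  - exact: cst_continuous.
  - by move=> f g cf cg; exact: continuousD.
  - by move=> i _; have [] := d2 i i.
have /nbhs_cball[s s0 sA] : nbhs x0 (A `&` [set x | c / 2 < laplacian phi x]).
  apply: filterI; first exact: open_nbhs_nbhs.
  have lc : laplacian phi @ x0 --> c by exact: lapc.
  apply: (lc [set r | c / 2 < r]); apply: open_nbhs_nbhs; split; first exact: open_gt.
  by rewrite /= ltr_pdivrMr// ltr_pMr// ltr1n.
have [w Fw wx0] := Ginf x0 (eta * s) (mulr_gt0 eta0 s0).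
have [cw ws] := Fs w Fw.
have phiB : C2_on (dball x0 s) phi.
  by apply: C2_onS phiA => x /dball_cball/sA[].
pose f x := -1 * phi x + (w x + peval (eta *: sqdist x0) x).
have fE x : f x = w x - phi x + eta * peval (sqdist x0) x.
  by rewrite /f pevalZ; ring.
have [|||z zs zmin] := @interior_min _ _ x0 s f x0 s0.
- move=> x /sA[Ax _]; apply: continuous_lin; first by have [] := phiA _ Ax.
  by apply: continuousD; [exact: cw|exact: continuous_peval].
- exact: dball_center.
- move=> z zs; rewrite !fE sqdistxx mulr0 addr0 zs phix0.
  have [|Az _] := sA z; first by rewrite /cball /= zs.
  have := phile z Az; have := GF w z Fw; move: wx0; lra.
pose P : mpol N R := mpoly.mpolyC N (f z) - eta *: sqdist x0.
have [C2' lap'] := C2_on_lin 1 (@open_dball _ _ x0 s) phiB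
  (C2_on_peval (A := dball x0 s) P).
have := ws z _ _ (@open_dball _ _ x0 s) zs C2'; rewrite lap'//.
rewrite laplacian_peval plapB plapC plapZ plap_sqdist sub0r pevalN pevalZ pevalC etaE.
have [Az lz] := sA z (dball_cball zs).
move=> H; have : 1 * laplacian phi z - c / 2 <= 0.
  apply: H => [|x xs]; first by rewrite pevalB pevalC pevalZ fE; ring.
  have := zmin x (dball_cball xs); rewrite pevalB pevalC pevalZ !fE; lra.
by move: lz => /=; lra.
Qed.

Context (N0 : (0 < N)%N) (Psi w0 : 'rV[R]_N -> R) (L : R) (lPsi : lip L Psi).

Definition supersol w :=
  [/\ continuous w, viscosity_superharmonic w & forall x, Psi x <= w x].

Hypothesis w0S : supersol w0.

Definition perron x : R := inf [set w x | w in supersol].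

Lemma perron_has_inf x : has_inf [set w x | w in supersol].
Proof.
split; first by exists (w0 x); exists w0.
by exists (Psi x) => _ [w [_ _ wPsi] <-]; exact: wPsi.
Qed.

Lemma perron_le w x : supersol w -> perron x <= w x.
Proof. by move=> wS; apply: ge_inf; [have [] := perron_has_inf x|exists w]. Qed.

Lemma perron_glb x (a : R) : (forall w, supersol w -> a <= w x) -> a <= perron x.
Proof.
move=> aw; apply: lb_le_inf; first by have [] := perron_has_inf x.
by move=> _ [w wS <-]; exact: aw.
Qed.

Lemma perron_ge x : Psi x <= perron x.
Proof. by apply: perron_glb => w []. Qed.

Lemma perron_adherent x (e : R) : 0 < e -> exists2 w, supersol w & w x < perron x + e.
Proof.
move=> e0; have [_ [w wS <-] we] := inf_adherent e0 (perron_has_inf x).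
by exists w.
Qed.

Lemma perron_lip : lip L perron.
Proof.
have [L0 PL] := lPsi; split => // x z.
suff le a b : perron a <= perron b + L * `|a - b|.
  rewrite ler_norml; have := le x z; have := le z x; rewrite distrC.
  by move=> ? ?; apply/andP; split; lra.
rewrite -lerBlDr; apply: perron_glb => w [cw ws wPsi]; rewrite lerBlDr.
pose sg : 'rV[R]_N := const_mx 1.
have sg1 i : sg 0 i ^+ 2 = 1 by rewrite mxE expr1n.
pose T := signed_shift sg (b - a).
have TE c : T c = c + (b - a) by apply/rowP => i; rewrite !mxE mul1r.
(* The added constant makes up for the change of the [L]-Lipschitz obstacle under the
   translation. *)
pose w' x := (w \o T) x + peval (mpoly.mpolyC N (L * `|a - b|)) x.
have w'S : supersol w'.
  split.
  - move=> c; apply: continuousD; last exact: continuous_peval.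
    by apply: continuous_comp; [exact: signed_shift_continuous|exact: cw].
  - apply: visc_add_harmonic; first exact: plapC.
    exact: visc_signed_shift.
  - move=> c; rewrite /w' pevalC /=; have := wPsi (T c); have := PL c (T c).
    have -> : c - T c = a - b by rewrite TE opprD addrA subrr sub0r opprB.
    by rewrite ler_norml => /andP[_]; lra.
apply: le_trans (perron_le a w'S) _.
by rewrite /w' pevalC /= TE [a + _]addrC subrK.
Qed.

Lemma perron_superharmonic : viscosity_superharmonic perron.
Proof.
apply: (@visc_inf N0 supersol); [by move=> w []| |exact: perron_adherent].
by move=> w x; exact: perron_le.
Qed.

Lemma perron_sym (sg : 'rV[R]_N) : (forall i, sg 0 i ^+ 2 = 1) ->
  (forall x, Psi (signed_shift sg 0 x) = Psi x) ->
  forall x, perron (signed_shift sg 0 x) = perron x.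
Proof.
move=> sg1 Psisg.
have TK x : signed_shift sg 0 (signed_shift sg 0 x) = x.
  by apply/rowP => i; rewrite !mxE !addr0 mulrA -expr2 sg1 mul1r.
have le x : perron x <= perron (signed_shift sg 0 x).
  apply: perron_glb => w [cw ws wPsi].
  suff /(perron_le x) : supersol (w \o signed_shift sg 0) by [].
  split; last by move=> c; rewrite -Psisg; exact: wPsi.
  - by move=> c; apply: continuous_comp; [exact: signed_shift_continuous|exact: cw].
  - exact: visc_signed_shift.
by move=> x; apply/eqP; rewrite eq_le le -[X in _ <= perron X]TK le.
Qed.

(* Replacing [perron] in a ball by the harmonic function with the same boundary
   values gives a smaller supersolution. *)
Lemma perron_lift y s : 0 < s ->
  (forall H, continuous H -> C2_on (dball y s) H ->
     (forall x, dball y s x -> laplacian H x = 0) ->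
     (forall x, peval (sqdist y) x = s -> Psi x <= H x) ->
     (forall x, peval (sqdist y) x = s -> H x = perron x) ->
     forall x, dball y s x -> Psi x <= H x) ->
  C2_on (dball y s) perron /\ forall x, dball y s x -> laplacian perron x = 0.
Proof.
move=> s0 PsiH.
have [H [cH HG C2H lapH]] := dirichlet_ball N0 y s0 perron_lip.
have Hs x : peval (sqdist y) x = s -> H x = perron x.
  by move=> xs; apply: HG; rewrite /dball /= xs ltxx.
have Hle x : H x <= perron x.
  have [xs|xs] := pselect (dball y s x); last by rewrite HG.
  apply: (comparison N0 s0 _ _ C2H _ _ _ (dball_cball xs)).
  - by move=> z _; exact: cH.
  - by move=> z _; exact: (lip_continuous perron_lip).
  - by move=> z /lapH ->.
  - exact: visc_super_onS perron_superharmonic.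
  - by move=> z /Hs ->.
have HS : supersol H.
  split=> // [x0 A phi oA Ax0 phiA phix0 phile|x].
    have [xs|xs] := pselect (dball y s x0).
      apply: (@C2_superharmonic_visc _ _ (dball y s) H) oA Ax0 xs phiA phix0 phile => //.
        exact: open_dball.
      by move=> z /lapH ->.
    (* Off the open ball [H] and [perron] agree, and [H <= perron] everywhere, so a function
       touching [H] there also touches [perron]. *)
    apply: (perron_superharmonic oA Ax0 phiA); first by rewrite phix0 HG.
    by move=> x /phile/le_trans; apply.
  have [xs|xs] := pselect (dball y s x); last by rewrite HG// perron_ge.
  by apply: PsiH xs => // z /Hs ->; exact: perron_ge.
have E : perron = H.
  by apply/funext => x; apply/eqP; rewrite eq_le Hle perron_le.
by rewrite E.
Qed.

End Perron.

(** * The barrier *)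

Section Barrier.
Context {R : realType} {N : nat}.
Implicit Types (u v w phi : 'rV[R]_N -> R) (A : set 'rV[R]_N) (x y z : 'rV[R]_N).

Let q : mpol N R := sqdist 0.
Let inv x : R := (enorm x)^-1.

Lemma enorm_sqdist x : enorm x = Num.sqrt (peval (sqdist 0) x).
Proof.
by rewrite /enorm peval_sqdist; congr Num.sqrt; apply: eq_bigr => i _; rewrite mxE subr0.
Qed.

Lemma enorm_sqr x : enorm x ^+ 2 = peval (sqdist 0) x.
Proof. by rewrite enorm_sqdist sqr_sqrtr// sqdist_ge0. Qed.

Lemma enorm_continuous : continuous (@enorm R N).
Proof.
have -> : @enorm R N = Num.sqrt \o peval (sqdist 0).
  by apply/funext => x; rewrite enorm_sqdist.
move=> x; apply: continuous_comp; first exact: continuous_peval.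
exact: sqrt_continuous.
Qed.

Definition punctured : set 'rV[R]_N := [set x | 0 < peval (sqdist 0) x].

Lemma open_punctured : open punctured.
Proof.
have -> : punctured = peval (sqdist 0) @^-1` [set r | 0 < r] by [].
apply: open_comp => [x _|]; first exact: continuous_peval.
exact: open_gt.
Qed.

Lemma enorm_gt0 x : punctured x -> 0 < enorm x.
Proof. by rewrite /punctured /= enorm_sqdist sqrtr_gt0. Qed.

Lemma inv_continuous x : punctured x -> {for x, continuous inv}.
Proof.
move=> x0; apply: continuousV; last exact: enorm_continuous.
by rewrite gt_eqF// enorm_gt0.
Qed.

(** With a = 1/|y| and b = 1/|x|, a - b = -(a^2 b^2 / (a + b)) (|y|^2 - |x|^2): the difference
    quotient reduces to that of a polynomial, and the square root is never differentiated. *)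
Lemma is_derive_inv x i : punctured x ->
  is_derive x (delta_mx 0 i) inv (- (x 0 i * inv x ^+ 3)).
Proof.
move=> x0; pose e : 'rV[R]_N := delta_mx 0 i.
have r0 := enorm_gt0 x0.
have qx : q = sqdist 0 by [].
have [dq qE] : is_derive x e (peval q) (2 * x 0 i).
  apply: is_derive_eq; first exact: is_derive_peval.
  rewrite (bigD1 i)//= mxE !eqxx mul1r big1 ?addr0 => [|j ji].
    by rewrite mdv_sqdist !pevalE mxE subr0 mulr_natl.
  by rewrite mxE eqxx (negbTE ji) mul0r.
have shc : (fun h : R => h *: e + x) @ 0^' --> x.
  have c : (fun h : R => h *: e + x) @ 0 --> 0 *: e + x.
    apply: cvgD; last exact: cvg_cst.
    by apply: cvgZr_tmp.
  rewrite scale0r add0r in c; apply: cvg_trans c; apply: cvg_app.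
  exact: nbhs_dnbhs.
have nb : \forall h \near (0 : R)^', punctured (h *: e + x).
  by apply: (shc punctured); apply: open_nbhs_nbhs; split; [exact: open_punctured|].
have c : (fun h : R => h^-1 *: ((inv \o shift x) (h *: e) - inv x)) @ 0^' -->
    - (x 0 i * inv x ^+ 3).
  have cinv : (fun h : R => inv (h *: e + x)) @ 0^' --> inv x.
    by apply: cvg_comp shc _; exact: inv_continuous.
  have cq : (fun h : R => h^-1 *: ((peval q \o shift x) (h *: e) - peval q x))
    @ 0^' --> 2 * x 0 i by rewrite -qE; exact: dq.
  have -> : - (x 0 i * inv x ^+ 3) =
      - (inv x ^+ 2 * inv x ^+ 2 * (inv x + inv x)^-1) * (2 * x 0 i).
    by rewrite /inv; field; rewrite gt_eqF.
  have cc : (fun h : R => - (inv (h *: e + x) ^+ 2 * inv x ^+ 2 *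
      (inv (h *: e + x) + inv x)^-1) *
      (h^-1 *: ((peval q \o shift x) (h *: e) - peval q x))) @ 0^' -->
      - (inv x ^+ 2 * inv x ^+ 2 * (inv x + inv x)^-1) * (2 * x 0 i).
    apply: cvgM cq; apply: cvgN; apply: cvgM.
      by apply: cvgM; [apply: cvgM|exact: cvg_cst].
    apply: cvgV; last by apply: cvgD => //; exact: cvg_cst.
    by rewrite gt_eqF// addr_gt0// invr_gt0.
  apply: cvg_trans cc; apply: near_eq_cvg; near=> h.
  have h0 : h != 0 by near: h; exact: nbhs_dnbhs_neq.
  have ph : punctured (h *: e + x) by near: h; exact: nb.
  have r1 := enorm_gt0 ph.
  rewrite /= -[h^-1 *: _]/(h^-1 * _) -[h^-1 *: (inv _ - _)]/(h^-1 * _) qx -!enorm_sqr.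
  rewrite /inv; field; rewrite h0 !gt_eqF// addr_gt0//.
by split; [exact: cvgP c|exact: cvg_lim c].
Unshelve. all: by end_near. Qed.

(** The factor [3 - N%:R] is where the dimension enters: 1/|x| is superharmonic off the origin when
    N >= 3. *)
Lemma inv_C2 : C2_on punctured inv /\
  forall x, punctured x -> laplacian inv x = (3 - N%:R) * inv x ^+ 3.
Proof.
have nb x : punctured x -> nbhs x punctured.
  by move=> x0; apply: open_nbhs_nbhs; split; [exact: open_punctured|].
have nd1 i x : punctured x ->
    \near x, (fun z => - (z 0 i * inv z ^+ 3)) x = partial i inv x.
  move=> /nb; apply: filterS => z z0.
  by have [_ <-] := is_derive_inv i z0.
have d2 i j x : punctured x -> is_derive x (delta_mx 0 j)
    (fun z => - (z 0 i * inv z ^+ 3))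
    (- ((i == j)%:R * inv x ^+ 3 - 3 * x 0 i * x 0 j * inv x ^+ 5)).
  move=> x0; have d := is_derive_inv j x0.
  have dc := is_derive_coord x (delta_mx 0 j) i.
  have -> : (fun z : 'rV[R]_N => - (z 0 i * inv z ^+ 3)) =
    - ((fun z : 'rV[R]_N => z 0 i) * inv ^+ 3) by [].
  apply: is_derive_eq.
  rewrite mxE eqxx andTb -[_ *: _]/(_ * _) -[X in _ + X]/(_ * _) /= -[_ *: _]/(_ * _).
  by rewrite -[(inv ^+ 3) x]/(inv x ^+ 3); case: (i == j) => /=; ring.
have nd2 i j x : punctured x -> \near x,
    (fun z => - ((i == j)%:R * inv z ^+ 3 - 3 * z 0 i * z 0 j * inv z ^+ 5)) x =
    partial j (partial i inv) x.
  move=> /nb; apply: filterS => z z0.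
  rewrite -(near_eq_partial _ (nd1 i z z0)).
  by have [_ <-] := d2 i j z z0.
have cX k x : punctured x -> {for x, continuous (fun z => inv z ^+ k)}.
  by move=> x0; apply: continuous_pow; exact: inv_continuous.
have cc i x : {for x, continuous (fun z : 'rV[R]_N => z 0 i : R)}.
  exact: coord_continuous.
have ck (c : R) x : {for x, continuous (fun z : 'rV[R]_N => c)}.
  exact: cst_continuous.
split=> [x x0|x x0].
  split; first exact: inv_continuous.
    move=> i; split; first by have [] := is_derive_inv i x0.
    apply: (near_eq_continuous (nd1 i x x0)); apply: continuousN.
    by apply: continuousM; [exact: cc|exact: cX].
  move=> i j; split.
    by have [d _] := d2 i j x x0; apply: near_eq_derivable d; exact: nd1.
  apply: (near_eq_continuous (nd2 i j x x0)); apply: continuousN; apply: continuousB.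
    by apply: continuousM; [exact: ck|exact: cX].
  apply: continuousM; last exact: cX.
  apply: continuousM; last exact: cc.
  by apply: continuousM; [exact: ck|exact: cc].
have r0 := enorm_gt0 x0.
rewrite /laplacian (eq_bigr (fun i => - inv x ^+ 3 + 3 * inv x ^+ 5 * x 0 i ^+ 2)).
  rewrite big_split /= sumr_const card_ord -mulr_sumr.
  have -> : \sum_i x 0 i ^+ 2 = enorm x ^+ 2.
    by rewrite enorm_sqr peval_sqdist; apply: eq_bigr => i _; rewrite mxE subr0.
  by rewrite -mulr_natr /inv; field; rewrite gt_eqF.
by move=> i _; rewrite -(nbhs_singleton (nd2 i i x x0)) eqxx /= mulr1n; ring.
Qed.

End Barrier.

Lemma bernoulli_ineq {R : realDomainType} (r : R) m : 0 <= r ->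
  1 + m%:R * (r - 1) <= r ^+ m.
Proof.
move=> r0; elim: m => [|m IHm]; first by rewrite expr0 mul0r addr0.
rewrite exprS; apply: le_trans (ler_wpM2l r0 IHm).
rewrite -subr_ge0 -natr1.
have -> : r * (1 + m%:R * (r - 1)) - (1 + (m%:R + 1) * (r - 1)) =
  m%:R * (r - 1) ^+ 2 by ring.
by rewrite mulr_ge0 ?sqr_ge0.
Qed.

(** Says that q > 0 at radius 2 for every [k]. Hence one cube of half-side 2 serves as cut-off for
    all [k], and 2 is an admissible radius in part (i). *)
Lemma expr2_gt_linear {R : realType} k : (0 < k)%N ->
  1 + (2 * k)%:R < 2 ^+ (2 * k) :> R.
Proof.
move=> k0; have := bernoulli_ineq k (ler0n R 4); rewrite exprM.
have -> : (2 ^+ 2 : R) = 4 by rewrite expr2; lra.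
move=> h; apply: lt_le_trans h; rewrite natrM.
have : 0 < k%:R :> R by rewrite ltr0n.
lra.
Qed.

Section BarrierFunction.
Context {R : realType} {N : nat}.
Implicit Types (u v w phi : 'rV[R]_N -> R) (A : set 'rV[R]_N) (x y z : 'rV[R]_N).

Lemma mdvXn i (P : mpol N R) k : mdv i (P ^+ k) = P ^+ k.-1 * mdv i P *+ k.
Proof.
elim: k => [|k IHk].
  by rewrite expr0 mulr0n -(mpoly.mpolyC1 N R) mpoly.mderivC.
rewrite exprS mpoly.mderivM IHk; case: k {IHk} => [|k] /=.
  by rewrite mulr0n mulr0 addr0 mulr1n mulrC.
by rewrite mulrnAr mulrA -exprS [mdv i P * _]mulrC -mulrS.
Qed.

Lemma plap_sqdistXn_ge0 y k x : 0 <= peval (plap (sqdist y ^+ k)) x.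
Proof.
elim: k => [|k IHk].
  by rewrite expr0 -(mpoly.mpolyC1 N R) plapC peval0.
rewrite exprS peval_plapM plap_sqdist pevalC pevalXn.
have q0 := sqdist_ge0 y x.
have g0 : 0 <= gdot (sqdist y) (sqdist y ^+ k) x.
  apply: sumr_ge0 => i _; rewrite mdvXn pevalMn pevalM pevalXn mulrnAr.
  apply: mulrn_wge0; rewrite mulrCA; apply: mulr_ge0; first exact: exprn_ge0.
  by rewrite -expr2 sqr_ge0.
apply: addr_ge0; last exact: mulrn_wge0.
apply: addr_ge0; last exact: mulr_ge0.
by apply: mulr_ge0; [exact: mulr_ge0|exact: exprn_ge0].
Qed.

(* On the unit ball the barrier is [1 + 2k - |x|^(2k)]; outside it is continued by
   [2k / |x|], superharmonic as N >= 3, and the two pieces match to first order on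
   the unit sphere. *)
Definition barrier k x : R :=
  1 - Num.min (enorm x) 1 ^+ (2 * k) + (2 * k)%:R / Num.max (enorm x) 1.

Lemma enorm_ge0 x : 0 <= enorm x.
Proof. exact: sqrtr_ge0. Qed.

Lemma barrier_in k x : enorm x <= 1 ->
  barrier k x = 1 + (2 * k)%:R - enorm x ^+ (2 * k).
Proof.
by move=> x1; rewrite /barrier min_l// max_r// divr1 addrAC.
Qed.

Lemma barrier_out k x : 1 <= enorm x -> barrier k x = (2 * k)%:R / enorm x.
Proof.
by move=> x1; rewrite /barrier min_r// max_l// expr1n subrr add0r.
Qed.

(** Multiplied by r = |x|, this is Bernoulli's inequality r^(2k+1) >= 1 + (2k+1)(r - 1), with
    equality at r = 1. *)
Lemma barrier_le_inv k x : 0 < enorm x ->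
  1 + (2 * k)%:R - enorm x ^+ (2 * k) <= (2 * k)%:R / enorm x.
Proof.
move=> r0; rewrite ler_pdivlMr//.
have := bernoulli_ineq (2 * k).+1 (ltW r0); rewrite exprS -natr1.
by move: ((2 * k)%:R : R) (enorm x ^+ (2 * k)) => c p; lra.
Qed.

Lemma barrier_ge k x : 1 + (2 * k)%:R - enorm x ^+ (2 * k) <= barrier k x.
Proof.
have [x1|x1] := leP (enorm x) 1; first by rewrite barrier_in.
rewrite (barrier_out _ (ltW x1)); apply: barrier_le_inv.
exact: lt_trans x1.
Qed.

Lemma barrier_ge0 k x : 0 <= barrier k x.
Proof.
have [x1|/ltW x1] := leP (enorm x) 1.
  rewrite barrier_in// addrAC addr_ge0// subr_ge0 exprn_ile1//.
  exact: enorm_ge0.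
by rewrite barrier_out// divr_ge0// enorm_ge0.
Qed.

Lemma barrier_le k x : barrier k x <= 1 + (2 * k)%:R.
Proof.
have [x1|/ltW x1] := leP (enorm x) 1.
  by rewrite barrier_in// gerBl exprn_ge0// enorm_ge0.
rewrite barrier_out// ler_wpDl//; rewrite ler_pdivrMr ?(lt_le_trans _ x1)//.
by rewrite ler_peMr.
Qed.

Lemma barrier_continuous k : continuous (barrier k).
Proof.
have ck (c : R) x : {for x, continuous (fun z : 'rV[R]_N => c)}.
  exact: cst_continuous.
have ce x : {for x, continuous (@enorm R N)} by exact: enorm_continuous.
have -> : barrier k = ((fun=> 1) - (fun z => Num.min (enorm z) 1 ^+ (2 * k))) +
    (fun=> (2 * k)%:R) * (fun z => (Num.max (enorm z) 1)^-1) by [].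
move=> x; apply: continuousD.
  apply: continuousB; first exact: ck.
  by apply: continuous_pow; apply: continuous_min; [exact: ce|exact: ck].
apply: continuousM; first exact: ck.
apply: continuousV; last by apply: continuous_max; [exact: ce|exact: ck].
by rewrite gt_eqF// lt_max ltr01 orbT.
Qed.

(** Inside the unit ball the barrier is a superharmonic polynomial. At a point on or outside the
    sphere it equals 2k/|x|, and it lies below 2k/|x| on the punctured space, so a function touching
    it there touches 2k/|x| as well. *)
Lemma barrier_superharmonic k : (3 <= N)%N -> viscosity_superharmonic (barrier k).
Proof.
move=> N3 x0 A phi oA Ax0 phiA phix0 phile.
have [x1|x1] := ltP (enorm x0) 1.
  pose P : mpol N R := mpoly.mpolyC N (1 + (2 * k)%:R) - sqdist 0 ^+ k.
  have PE x : peval P x = 1 + (2 * k)%:R - enorm x ^+ (2 * k).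
    by rewrite /P pevalB pevalC pevalXn -enorm_sqr exprM.
  have oB : open (dball (0 : 'rV[R]_N) 1) by exact: open_dball.
  have dE (x : 'rV[R]_N) : dball 0 1 x <-> enorm x < 1.
    rewrite /dball /= -enorm_sqr; split=> h; last by rewrite expr_lt1// enorm_ge0.
    by move: h; rewrite expr_lt1// enorm_ge0.
  have ssP : visc_super_on (dball 0 1) (peval P).
    apply: C2_superharmonic_visc => //; first exact: C2_on_peval.
    move=> x _; rewrite laplacian_peval plapB plapC sub0r pevalN oppr_le0.
    exact: plap_sqdistXn_ge0.
  apply: (ssP x0 (A `&` dball 0 1)); first exact: openI.
  - by split => //; apply/dE.
  - by apply/dE.
  - by apply: C2_onS phiA => x [].
  - by rewrite phix0 PE barrier_in// ltW.
  - move=> x [Ax /dE x1']; by rewrite PE -(barrier_in _ (ltW x1')) phile.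
have p0 : punctured x0.
  by rewrite /punctured /= -enorm_sqr exprn_gt0// (lt_le_trans _ x1).
have [C2i lapi] := @inv_C2 R N.
have C20 : C2_on (@punctured R N) (peval (0 : mpol N R)) by exact: C2_on_peval.
have [C2' lap'] := C2_on_lin (2 * k)%:R (@open_punctured R N) C2i C20.
have ss : visc_super_on (@punctured R N)
    (fun x => (2 * k)%:R * (enorm x)^-1 + peval (0 : mpol N R) x).
  apply: C2_superharmonic_visc C2' _; first exact: open_punctured.
  move=> x px; rewrite lap'// lapi// laplacian_peval plap0.
  rewrite peval0 addr0 mulr_ge0_le0// mulr_le0_ge0//.
    by rewrite subr_le0 ler_nat.
  by rewrite exprn_ge0// invr_ge0 enorm_ge0.
apply: (ss x0 (A `&` @punctured R N)) => //.
- by apply: openI => //; exact: open_punctured.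
- by apply: C2_onS phiA => x [].
- by rewrite phix0 peval0 addr0 barrier_out.
move=> x [Ax px]; rewrite peval0 addr0; apply: le_trans (phile x Ax) _.
have r0 := enorm_gt0 px.
have [y1|/ltW y1] := leP (enorm x) 1; last by rewrite barrier_out.
by rewrite barrier_in//; exact: barrier_le_inv.
Qed.

Lemma visc_scale w (c : R) : 0 < c -> viscosity_superharmonic w ->
  viscosity_superharmonic (fun x => c * w x).
Proof.
move=> c0 ws x0 A phi oA Ax0 phiA phix0 phile.
have C20 : C2_on A (peval (0 : mpol N R)) by exact: C2_on_peval.
have [C2' lap'] := C2_on_lin c^-1 oA phiA C20.
have := ws x0 _ _ oA Ax0 C2'; rewrite lap'// laplacian_peval plap0.
move=> H; have : c^-1 * laplacian phi x0 + peval 0 x0 <= 0.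
  apply: H => [|x Ax]; rewrite peval0 addr0.
    by rewrite phix0 mulKf// gt_eqF.
  by rewrite mulrC ler_pdivrMr// mulrC phile.
by rewrite peval0 addr0 pmulr_rle0// invr_gt0.
Qed.

End BarrierFunction.

(** * Growth and even harmonic extension of polynomials *)

Section Growth.
Context {R : realType} {N : nat}.
Implicit Types (P f : mpol N R) (x z : 'rV[R]_N).

Lemma coord_le_enorm x i : `|x 0 i| <= enorm x.
Proof.
rewrite -sqrtr_sqr /enorm ler_wsqrtr// (bigD1 i)//= lerDl sumr_ge0// => j _.
exact: sqr_ge0.
Qed.

Lemma enormZ (c : R) x : enorm (c *: x) = `|c| * enorm x.
Proof.
rewrite /enorm -sqrtr_sqr -sqrtrM ?sqr_ge0// mulr_sumr; congr Num.sqrt.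
by apply: eq_bigr => i _; rewrite mxE exprMn.
Qed.

Lemma degle_growth P d : degle P d ->
  exists2 C : R, 0 <= C & forall x, `|peval P x| <= C * (1 + enorm x) ^+ d.
Proof.
move=> /degleP Pd; exists (\sum_(m <- mpoly.msupp P) `|mpoly.mcoeff m P|) => [|x].
  by apply: sumr_ge0.
have x1 : 1 <= 1 + enorm x by rewrite lerDl enorm_ge0.
rewrite /peval mpoly.mevalE mulr_suml; apply: le_trans (ler_norm_sum _ _ _) _.
rewrite [leLHS]big_seq [leRHS]big_seq; apply: ler_sum => m mP.
rewrite normrM ler_wpM2l//.
apply: (@le_trans _ _ ((1 + enorm x) ^+ mpoly.mdeg m)); last first.
  by rewrite ler_weXn2l// Pd// -mpoly.mcoeff_msupp.
rewrite normr_prod mpoly.mdegE expr_sum; apply: ler_prod => i _.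
rewrite normr_ge0 normrX lerXn2r ?nnegrE// ?(le_trans ler01)//.
by apply: le_trans (coord_le_enorm x i) _; rewrite lerDr.
Qed.

(** If the degree m exceeds [k], the homogeneous part [F] of degree m satisfies s^m |F x| =
    O(s^(m-1)) along each ray. Thus [F] vanishes, contradicting the degree. *)
Lemma growth_degle f (C : R) k :
  (forall x, `|peval f x| <= C * (1 + enorm x ^+ k)) -> degle f k.
Proof.
move=> fC; rewrite /degle leqNgt; apply/negP => kf.
pose m := (mpoly.msize f).-1.
have mE : mpoly.msize f = m.+1 by rewrite /m prednK//; exact: leq_trans kf.
have {kf} km : (k < m)%N by rewrite mE ltnS in kf.
have fm : degle f m by rewrite /degle mE.
pose F := \sum_(mu <- mpoly.msupp f | mpoly.mdeg mu == m)
  mpoly.mcoeff mu f *: mpoly.mpolyX R mu.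
have fF : degle (f - F) m.-1.
  have -> : f - F = \sum_(mu <- mpoly.msupp f | mpoly.mdeg mu != m)
      mpoly.mcoeff mu f *: mpoly.mpolyX R mu.
    rewrite [X in X - F](mpoly.mpolyE f) (bigID (fun mu => mpoly.mdeg mu == m))/=.
    by rewrite -/F addrAC subrr add0r.
  rewrite big_seq_cond; apply: degle_sum => mu /andP[muf mum].
  rewrite /degle (leq_trans (mpoly.msizeZ_le _ _))// mpoly.msizeX.
  move/degleP : fm => /(_ mu); rewrite -mpoly.mcoeff_msupp muf => /(_ isT).
  by rewrite leq_eqVlt (negbTE mum)/= prednK// (leq_trans _ km).
have FZ (s : R) x : peval F (s *: x) = s ^+ m * peval F x.
  rewrite /F !peval_sum mulr_sumr; apply: eq_bigr => mu /eqP mum.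
  rewrite !pevalZ /peval !mpoly.mevalX mulrCA; congr (_ * _).
  rewrite -mum mpoly.mdegE expr_sum -big_split/=; apply: eq_bigr => i _.
  by rewrite mxE exprMn.
have [C' C'0 fFC] := degle_growth fF.
suff F0 : F = 0 by move: fF; rewrite F0 subr0 /degle mE; case: (m) km => //= ? _; rewrite ltnn.
apply: (@peval_near_eq0 _ _ _ 0); apply: filterE => x.
have C0 : 0 <= C.
  have := le_trans (normr_ge0 _) (fC 0).
  by rewrite pmulr_lge0// ltr_pwDl// exprn_ge0// enorm_ge0.
pose e := 1 + enorm x; have e1 : 1 <= e by rewrite lerDl enorm_ge0.
have e0 : 0 <= e by exact: le_trans e1.
pose D := C * (1 + e ^+ k) + C' * e ^+ m.-1.
have D0 : 0 <= D.
  apply: addr_ge0; apply: mulr_ge0 => //; last exact: exprn_ge0.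
  by apply: addr_ge0 => //; exact: exprn_ge0.
have FD (s : R) : 1 <= s -> s * `|peval F x| <= D.
  move=> s1; have s0 : 0 < s by exact: lt_le_trans s1.
  have sm : s ^+ m = s * s ^+ m.-1 by rewrite -exprS prednK// (leq_trans _ km).
  have p0 : 0 < s ^+ m.-1 by rewrite exprn_gt0.
  rewrite -(ler_pM2l p0) mulrA [_ * s]mulrC -sm.
  have -> : s ^+ m * `|peval F x| = `|peval F (s *: x)|.
    by rewrite FZ normrM ger0_norm// exprn_ge0// ltW.
  have -> : peval F (s *: x) = peval f (s *: x) - peval (f - F) (s *: x).
    by rewrite pevalB; ring.
  apply: le_trans (ler_normB _ _) _; rewrite /D mulrDr; apply: lerD.
    apply: le_trans (fC _) _; rewrite mulrCA ler_wpM2l// mulrDr mulr1.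
    apply: lerD; first by rewrite exprn_ege1.
    rewrite enormZ (gtr0_norm s0) exprMn ler_pM ?exprn_ge0 ?enorm_ge0 ?(ltW s0)//.
      by rewrite ler_weXn2l// -ltnS prednK// (leq_trans _ km).
    by rewrite lerXn2r ?nnegrE ?enorm_ge0// lerDr.
  apply: le_trans (fFC _) _; rewrite mulrCA ler_wpM2l// -exprMn.
  rewrite lerXn2r ?nnegrE ?addr_ge0 ?enorm_ge0 ?mulr_ge0 ?(ltW s0)//.
  by rewrite enormZ (gtr0_norm s0) mulrDr mulr1 lerD2r.
clearbody D; apply/eqP; rewrite -normr_le0 leNgt; apply/negP => F0.
(* At this scale the left side of [FD] is |F x| + D + 1, which exceeds [D]. *)
have := FD (1 + (D + 1) / `|peval F x|).
rewrite lerDl divr_ge0 ?addr_ge0// => /(_ isT).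
by rewrite mulrDl mul1r divfK ?gt_eqF//; move: F0; lra.
Qed.

Lemma poly_lip_cube P (r : R) : 0 <= r ->
  exists2 C, 0 <= C & forall x z, `|x| <= r -> `|z| <= r ->
    `|peval P x - peval P z| <= C * `|x - z|.
Proof.
move=> r0.
(* The sup bound [B] is carried along because the Lipschitz constant of a product involves it. *)
suff [C [B [C0 B0 _ PC]]] : exists C B, [/\ 0 <= C, 0 <= B,
    forall x, `|x| <= r -> `|peval P x| <= B &
    forall x z, `|x| <= r -> `|z| <= r -> `|peval P x - peval P z| <= C * `|x - z|].
  by exists C.
elim/(@mpoly_ring_ind R N): P => [c|i|P Q [C [B [C0 B0 PB PC]]] [C' [B' [C'0 B'0 QB QC]]]|
    P Q [C [B [C0 B0 PB PC]]] [C' [B' [C'0 B'0 QB QC]]]].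
- exists 0, `|c|; split=> // [x _|x z _ _]; rewrite !pevalC//.
  by rewrite subrr normr0 mul0r.
- exists 1, r; split=> // [x xr|x z _ _]; rewrite !pevalX.
    exact: le_trans (normr_coord x i) xr.
  by rewrite mul1r; have := normr_coord (x - z) i; rewrite !mxE.
- exists (C + C'), (B + B'); split; [exact: addr_ge0|exact: addr_ge0| |].
    move=> x xr; rewrite pevalD; apply: le_trans (ler_normD _ _) _.
    by apply: lerD; [exact: PB|exact: QB].
  move=> x z xr zr; rewrite !pevalD.
  have -> : peval P x + peval Q x - (peval P z + peval Q z) =
    (peval P x - peval P z) + (peval Q x - peval Q z) by ring.
  apply: le_trans (ler_normD _ _) _; rewrite mulrDl.
  by apply: lerD; [exact: PC|exact: QC].
- exists (B * C' + C * B'), (B * B'); split.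
  + by apply: addr_ge0; exact: mulr_ge0.
  + exact: mulr_ge0.
  + move=> x xr; rewrite pevalM normrM; apply: ler_pM => //; [exact: PB|exact: QB].
  move=> x z xr zr; rewrite !pevalM.
  have -> : peval P x * peval Q x - peval P z * peval Q z =
    peval P x * (peval Q x - peval Q z) + (peval P x - peval P z) * peval Q z by ring.
  apply: le_trans (ler_normD _ _) _; rewrite !normrM mulrDl; apply: lerD.
    by rewrite -mulrA; apply: ler_pM => //; [exact: PB|exact: QC].
  by rewrite mulrAC; apply: ler_pM => //; [exact: PC|exact: QB].
Qed.

(** The truncated subtraction gives only degree 0 beyond [d]; the second conclusion adds that the
    iterate actually vanishes there. *)
Lemma iter_plap P d k : degle P d ->
  degle (iter k plap P) (d - 2 * k) /\ ((d < 2 * k)%N -> iter k plap P = 0).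
Proof.
move=> Pd; elim: k => [|k [IH1 IH2]]; first by rewrite subn0.
split=> [|dk]; first by rewrite iterS mulnS addnC subnDA subn2; exact: degle_plap.
rewrite iterS; have [/IH2 ->|dk'] := ltnP d (2 * k).
  exact: plap0.
apply: plap_degle1; apply: degleW IH1.
by rewrite leq_subLR addn1 -ltnS (leq_trans dk)// mulnS.
Qed.

End Growth.

Section EvenExtension.
Context {R : realType} {n : nat}.
Implicit Types (g h : mpol n R) (a : 'rV[R]_n) (x : 'rV[R]_(n + 1)).

Lemma pt_lshift a (t : R) i : pt a t 0 (lshift 1 i) = a 0 i.
Proof. by rewrite row_mxEl. Qed.

Lemma pt_rshift a (t : R) i : pt a t 0 (rshift n i) = t.
Proof. by rewrite row_mxEr ord1 mxE eqxx mulr1n. Qed.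

Lemma ptP x : x = pt (lsubmx x) (x 0 (rshift n 0)).
Proof.
apply/rowP => i; case: (split_ordP i) => j ->.
  by rewrite pt_lshift mxE.
by rewrite pt_rshift ord1.
Qed.

Lemma enorm_pt a (t : R) : enorm (pt a t) ^+ 2 = enorm a ^+ 2 + t ^+ 2.
Proof.
have E N (z : 'rV[R]_N) : enorm z ^+ 2 = \sum_i z 0 i ^+ 2.
  by rewrite sqr_sqrtr// sumr_ge0// => i _; exact: sqr_ge0.
rewrite !E.
rewrite big_split_ord big_ord1 /= pt_rshift; congr (_ + _).
by apply: eq_bigr => i _; rewrite pt_lshift.
Qed.

Lemma enorm_pt0 a : enorm (pt a 0 : 'rV[R]_(n + 1)) = enorm a.
Proof.
have := enorm_pt a 0; rewrite expr0n addr0 => /eqP.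
by rewrite eqrXn2 ?enorm_ge0// => /eqP.
Qed.

Let wid : n.-tuple (mpol (n + 1) R) := [tuple mvar (lshift 1 i) | i < n].
(** Views a polynomial in x' as a polynomial in (x', t) independent of t. *)
Let iota g : mpol (n + 1) R := mpoly.comp_mpoly wid g.

Lemma iotaC c : iota (mpoly.mpolyC n c) = mpoly.mpolyC (n + 1) c.
Proof. exact: mpoly.comp_mpolyC. Qed.

Lemma iotaX i : iota (mvar i) = mvar (lshift 1 i).
Proof. by rewrite /iota mpoly.comp_mpolyXU -tnth_nth tnth_mktuple. Qed.

Lemma iotaD g h : iota (g + h) = iota g + iota h.
Proof. exact: mpoly.comp_mpolyD. Qed.

Lemma iotaM g h : iota (g * h) = iota g * iota h.
Proof. exact: (mpoly.comp_mpoly_is_multiplicative wid).1. Qed.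

Lemma peval_iota g x : peval (iota g) x = peval g (lsubmx x).
Proof.
elim/(@mpoly_ring_ind R n): g => [c|i|g h IHg IHh|g h IHg IHh].
- by rewrite iotaC !pevalC.
- by rewrite iotaX !pevalX mxE.
- by rewrite iotaD !pevalD IHg IHh.
- by rewrite iotaM !pevalM IHg IHh.
Qed.

Lemma mdv_iota_lshift g i : mdv (lshift 1 i) (iota g) = iota (mdv i g).
Proof.
elim/(@mpoly_ring_ind R n): g => [c|j|g h IHg IHh|g h IHg IHh].
- by rewrite iotaC !mpoly.mderivC -(mpoly.mpolyC0 n R) iotaC mpoly.mpolyC0.
- by rewrite iotaX !mdvX iotaC (inj_eq (@lshift_inj _ _)).
- by rewrite iotaD !mpoly.mderivD iotaD IHg IHh.
- by rewrite iotaM !mpoly.mderivM iotaD !iotaM IHg IHh.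
Qed.

Lemma mdv_iota_rshift g i : mdv (rshift n i) (iota g) = 0.
Proof.
elim/(@mpoly_ring_ind R n): g => [c|j|g h IHg IHh|g h IHg IHh].
- by rewrite iotaC mpoly.mderivC.
- by rewrite iotaX mdvX eq_rlshift mpoly.mpolyC0.
- by rewrite iotaD mpoly.mderivD IHg IHh addr0.
- by rewrite iotaM mpoly.mderivM IHg IHh mul0r mulr0 addr0.
Qed.

(** For k < 2 the exponent [k.-2] is truncated, but its coefficient k (k - 1) is then zero. *)
Lemma plap_pow_iota g k :
  plap (mvar (rshift n 0) ^+ k * iota g) =
  mvar (rshift n 0) ^+ k * iota (plap g) +
  (k * k.-1)%:R *: (mvar (rshift n 0) ^+ k.-2 * iota g).
Proof.
rewrite {1}/plap big_split_ord big_ord1 /=; congr (_ + _).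
  have -> : iota (plap g) = \sum_i iota (mdv i (mdv i g)).
    apply: (big_morph iota iotaD).
    by rewrite -(mpoly.mpolyC0 n R) iotaC mpoly.mpolyC0.
  rewrite (@mulr_sumr _ 'I_n); apply: eq_bigr => i _.
  rewrite !mpoly.mderivM !mpoly.mderivD !mpoly.mderivM !mdvXn !mdvX eq_lrshift.
  by rewrite !mpoly.mpolyC0 !mulr0 !mul0rn !mpoly.mderiv0 !mul0r !add0r !mdv_iota_lshift.
have d1 j : mdv (rshift n 0) (mvar (rshift n 0) ^+ j) =
    j%:R *: mvar (rshift n 0) ^+ j.-1 :> mpol (n + 1) R.
  by rewrite mdvXn mdvX eqxx mpoly.mpolyC1 mulr1 scaler_nat.
rewrite mpoly.mderivM mdv_iota_rshift mulr0 addr0 d1 mpoly.mderivM.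
rewrite mdv_iota_rshift mulr0 addr0 mpoly.mderivZ d1 natrM.
by rewrite scalerA scalerAl.
Qed.

(** The extension is cos(t sqrt(Delta)) g, the sum of (-1)^k t^(2k) / (2k)! Delta^k g, finite on
    polynomials. The degree lost by Delta^k balances the factor t^(2k), so the growth does not
    increase. *)
Lemma even_extension g d : degle g d ->
  exists P : mpol (n + 1) R, [/\ plap P = 0,
    forall a, peval P (pt a 0) = peval g a,
    forall a t, peval P (pt a t) = peval P (pt a (- t)) &
    exists2 C : R, 0 <= C & forall x, `|peval P x| <= C * (1 + enorm x) ^+ d].
Proof.
move=> gd; pose T : mpol (n + 1) R := mvar (rshift n 0).
pose c k : R := (-1) ^+ k / ((2 * k)`!)%:R.
pose K := d./2.+1.
pose term k : mpol (n + 1) R := c k *: (T ^+ (2 * k) * iota (iter k plap g)).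
have kd k : (k < K)%N -> (2 * k <= d)%N.
  rewrite ltnS => kK; rewrite mul2n; apply: leq_trans (_ : d./2.*2 <= d)%N.
    by rewrite leq_double.
  by rewrite -[X in (_ <= X)%N](odd_double_half d) leq_addl.
have gK : iter K plap g = 0.
  have [_] := iter_plap K gd; apply.
  by rewrite mul2n /K doubleS -{1}(odd_double_half d); case: (odd d).
have termE a t k : peval (term k) (pt a t) =
    c k * (t ^+ (2 * k) * peval (iter k plap g) a).
  by rewrite /term pevalZ pevalM pevalXn pevalX pt_rshift peval_iota /pt row_mxKl.
have PE a t : peval (\sum_(k < K) term k) (pt a t) =
    \sum_(k < K) c k * (t ^+ (2 * k) * peval (iter k plap g) a).
  by rewrite peval_sum; apply: eq_bigr => k _; rewrite termE.
exists (\sum_(k < K) term k); split.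
(* The Laplacian of each term is [A k.+1 - A k], so the sum telescopes to [A K], zero because 2K >
   d. *)
- pose A k : mpol (n + 1) R := if k is k'.+1 then
    c k' *: (T ^+ (2 * k') * iota (iter k plap g)) else 0.
  have tA k : plap (term k) = A k.+1 - A k.
    rewrite plapZ plap_pow_iota scalerDr; congr (_ + _); case: k => [|k].
      by rewrite scale0r scaler0 oppr0.
    have E2 : (2 * k.+1 = (2 * k).+2)%N by rewrite mulnS.
    rewrite scalerA -scaleNr E2; congr (_ *: _).
    rewrite /c E2 exprS !factS !natrM -pred_Sn.
    have f0 : ((2 * k)`!)%:R != 0 :> R by rewrite pnatr_eq0 -lt0n fact_gt0.
    have f1 : (2 * k).+1%:R != 0 :> R by rewrite pnatr_eq0.
    have f2 : (2 * k).+2%:R != 0 :> R by rewrite pnatr_eq0.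
    move: f0 f1 f2; move: (_`!%:R) ((2 * k).+1%:R : R) ((2 * k).+2%:R : R) => f a b *.
    by field; apply/and3P.
  have -> : plap (\sum_(k < K) term k) = \sum_(k < K) plap (term k).
    exact: (big_morph _ plapD plap0).
  rewrite (eq_bigr (fun k : 'I_K => A k.+1 - A k)) => [|k _]; last exact: tA.
  rewrite -(big_mkord xpredT (fun k => A k.+1 - A k)) telescope_sumr// subr0.
  have -> : A K = c d./2 *: (T ^+ (2 * d./2) * iota (iter K plap g)) by [].
  rewrite gK.
  have -> : iota 0 = 0 by rewrite -(mpoly.mpolyC0 n R) iotaC mpoly.mpolyC0.
  by rewrite mulr0 scaler0.
- move=> a; rewrite PE /K big_ord_recl big1 => [|k _].
    by rewrite /c /= muln0 fact0 !expr0 divr1 !mul1r addr0.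
  by rewrite /= /bump /= add1n mulnS exprS !mul0r mulr0.
- move=> a t; rewrite !PE; apply: eq_bigr => k _.
  by rewrite !exprM sqrrN.
have /choice[C CP] (k : 'I_K) : exists C : R, 0 <= C /\ forall x,
    `|peval (term k) x| <= C * (1 + enorm x) ^+ d.
  have [dk _] := iter_plap k gd.
  have [C C0 hC] := degle_growth dk.
  exists (`|c k| * C); split=> [|x]; first by rewrite mulr_ge0.
  rewrite (ptP x); move: (lsubmx x) (x 0 _) => a t.
  rewrite termE normrM [X in _ * X <= _]normrM normrX.
  have e1 : 1 <= 1 + enorm (pt a t) by rewrite lerDl enorm_ge0.
  have e0 : 0 <= 1 + enorm (pt a t) by exact: le_trans e1.
  have t1 : `|t| <= 1 + enorm (pt a t).
    have := coord_le_enorm (pt a t) (rshift n 0).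
    by rewrite pt_rshift => /le_trans; apply; rewrite lerDr.
  have ea1 : 1 + enorm a <= 1 + enorm (pt a t).
    rewrite lerD2l -ler_sqr ?nnegrE ?enorm_ge0//.
    by rewrite enorm_pt lerDl sqr_ge0.
  rewrite -mulrA; apply: ler_wpM2l => //.
  rewrite -(subnKC (kd k (ltn_ord k))) exprD mulrCA; apply: ler_pM => //.
    by rewrite lerXn2r ?nnegrE.
  apply: le_trans (hC _) _; apply: ler_wpM2l => //.
  by rewrite lerXn2r ?nnegrE// addr_ge0// enorm_ge0.
exists (\sum_(k < K) C k) => [|x]; first by apply: sumr_ge0 => k _; have [] := CP k.
rewrite peval_sum mulr_suml; apply: le_trans (ler_norm_sum _ _ _) _.
by apply: ler_sum => k _; have [_] := CP k; apply.
Qed.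

End EvenExtension.

(** * The thin obstacle problem *)

Section Clip.
Context {R : realType} {N : nat}.
Implicit Types (x z : 'rV[R]_N).

(** The 1-Lipschitz retraction onto the cube of half-side 2: composing with it cuts off the obstacle
    and keeps it globally Lipschitz. *)
Definition clip x : 'rV[R]_N := \row_i Num.max (- 2) (Num.min 2 (x 0 i)).

Lemma norm_le_enorm x : `|x| <= enorm x.
Proof. by apply: normr_rV_le => [|i]; [exact: enorm_ge0|exact: coord_le_enorm]. Qed.

Lemma clip_norm x : `|clip x| <= 2.
Proof.
apply: normr_rV_le => // i; rewrite mxE ler_norml le_max lexx/= ge_max ge_min lexx.
by rewrite andbT; lra.
Qed.

Lemma clip_id x : `|x| <= 2 -> clip x = x.
Proof.
move=> x2; apply/rowP => i; rewrite mxE.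
have := le_trans (normr_coord x i) x2; rewrite ler_norml => /andP[h1 h2].
by rewrite min_r// max_r.
Qed.

Lemma clip_lip x z : `|clip x - clip z| <= `|x - z|.
Proof.
apply: normr_rV_le => // i; apply: le_trans (normr_coord (x - z) i); rewrite !mxE.
move: (x 0 i) (z 0 i) => a b.
wlog ab : a b / a <= b.
  by move=> H; have [/H//|/ltW/H] := leP a b; rewrite distrC [X in _ <= X -> _]distrC.
rewrite [leRHS]distrC [leLHS]distrC !ger0_norm ?subr_ge0//.
  rewrite /Num.max /Num.min; do 4!case: ifP => //; rewrite ?ltNge => *; lra.
by rewrite /Num.max /Num.min; do 4!case: ifP => //; rewrite ?ltNge => *; lra.
Qed.

Lemma clip_boundary x : 2 <= `|x| -> exists i, `|clip x 0 i| = 2.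
Proof.
move=> x2; apply: contrapT => /forallNP cx.
have : `|x| < 2; last by rewrite ltNge x2.
have xi i : `|x 0 i| < 2.
  rewrite ltNge; apply/negP => xi; apply: (cx i); rewrite mxE.
  move: xi; rewrite ler_normr => /orP[h|h].
    by rewrite min_l// max_r ?ger0_norm//; lra.
  by rewrite min_r ?max_l ?normrN ?ger0_norm//; lra.
rewrite [ltLHS]/Num.norm/= mx_normrE; apply/bigmax_ltP; split => //= -[j i] _.
by rewrite ord1.
Qed.

End Clip.

Section ThinObstacle.
Context {R : realType} {n : nat}.

Lemma norm_pt_sub (a : 'rV[R]_n) (t : R) : `|pt a t - pt a 0| <= `|t|.
Proof.
apply: normr_rV_le => // i; rewrite [X in `|X|]mxE [X in _ + X]mxE.
case: (split_ordP i) => j ->; rewrite ?pt_lshift ?pt_rshift.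
  by rewrite subrr normr0.
by rewrite subr0.
Qed.

Lemma norm_pt0_le (a : 'rV[R]_n) (t : R) : `|pt a 0| <= `|pt a t|.
Proof.
apply: normr_rV_le => // i; case: (split_ordP i) => j ->.
  by rewrite pt_lshift -(pt_lshift a t) normr_coord.
by rewrite pt_rshift normr0.
Qed.

Definition flip : 'rV[R]_(n + 1) := pt (const_mx 1) (-1).

Lemma flip_sign i : flip 0 i ^+ 2 = 1.
Proof.
by case: (split_ordP i) => j ->; rewrite ?pt_lshift ?pt_rshift ?mxE ?sqrrN expr1n.
Qed.

Lemma flipE (a : 'rV[R]_n) (t : R) : signed_shift flip 0 (pt a t) = pt a (- t).
Proof.
have E i : signed_shift flip 0 (pt a t) 0 i = flip 0 i * pt a t 0 i.
  by rewrite mxE [X in _ + X]mxE addr0.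
apply/rowP => i; rewrite E; case: (split_ordP i) => j ->.
  by rewrite !pt_lshift mxE mul1r.
by rewrite !pt_rshift mulN1r.
Qed.

Lemma clip_flip x : clip (signed_shift flip 0 x) = signed_shift flip 0 (clip x).
Proof.
have E z i : signed_shift flip 0 z 0 i = flip 0 i * z 0 i.
  by rewrite mxE [X in _ + X]mxE addr0.
have cE z i : clip z 0 i = Num.max (- 2) (Num.min 2 (z 0 i)) by rewrite mxE.
apply/rowP => i; rewrite E !cE E; have /eqP := flip_sign i.
rewrite sqrf_eq1 => /orP[]/eqP->; first by rewrite !mul1r.
rewrite !mulN1r; move: (x 0 i) => c.
rewrite /Num.max /Num.min; do 4!case: ifP => //; rewrite ?ltNge => *; lra.
Qed.

End ThinObstacle.

Section Solution.
Context {R : realType} {n : nat} (hn : (2 <= n)%N).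
Context (p : mpol (n + 1) R) (g : 'rV[R]_n -> R) (delta : R) (k : nat).
Hypotheses (hp : plap p = 0) (p_thin : forall a : 'rV[R]_n, peval p (pt a 0) = g a).
Hypothesis p_even : forall (a : 'rV[R]_n) (t : R),
  peval p (pt a t) = peval p (pt a (- t)).
Hypotheses (delta0 : 0 < delta) (k0 : (0 < k)%N).
Hypothesis g_ge : forall a,
  delta * (enorm a ^+ (2 * k) - (1 + (2 * k)%:R)) <= g a.
Implicit Types (x z : 'rV[R]_(n + 1)) (a b : 'rV[R]_n) (t : R).

Let xt x : R := x 0 (rshift n 0).

Section Obstacle.
Context (C C2 : R).
Hypothesis pC : 0 <= C /\ forall x z, `|x| <= 2 -> `|z| <= 2 ->
  `|peval p x - peval p z| <= C * `|x - z|.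
Hypothesis qC : 0 <= C2 /\ forall x z, `|x| <= 2 -> `|z| <= 2 ->
  `|peval (sqdist 0 ^+ k) x - peval (sqdist 0 ^+ k) z| <= C2 * `|x - z|.

Let kappa : R := 1 + (2 * k)%:R.
(** [C] pays for the variation of [p] off the thin space, [delta * C2] for that of delta |x|^(2k),
    and the rest for negativity on the faces |t| = 2. *)
Let M : R := C + delta * C2 + delta * kappa + 1.

(* The slope [M] makes the obstacle smaller than the barrier, and negative on
   the boundary of the cube. *)
Definition obstacle0 x : R := - peval p x - M * `|xt x|.

Definition obstacle x : R := Num.max 0 (obstacle0 (clip x)).

Lemma kappa_gt0 : 0 < kappa.
Proof. by rewrite /kappa ltr_pwDl. Qed.

Lemma slope_ge0 : 0 <= M.
Proof.
have [C0 _] := pC; have [C20 _] := qC.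
have := mulr_ge0 (ltW delta0) C20; have := mulr_gt0 delta0 kappa_gt0.
by rewrite /M; lra.
Qed.

Lemma enorm_pow N (x : 'rV[R]_N) : enorm x ^+ (2 * k) = peval (sqdist 0 ^+ k) x.
Proof. by rewrite exprM enorm_sqr pevalXn. Qed.

Lemma obstacle0_le a t : `|pt a t| <= 2 ->
  obstacle0 (pt a t) <= - g a - (M - C) * `|t|.
Proof.
move=> x2; have [C0 PC] := pC.
have := PC _ _ x2 (le_trans (norm_pt0_le a t) x2); rewrite p_thin.
rewrite /obstacle0 /xt pt_rshift ler_norml => /andP[h _].
have := ler_wpM2l C0 (norm_pt_sub a t); move: h; lra.
Qed.

Lemma obstacle0_barrier x : `|x| <= 2 -> obstacle0 x <= delta * barrier k x.
Proof.
rewrite (ptP x); move: (lsubmx x) (x 0 _) => a t x2.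
have [C20 QC] := qC.
apply: le_trans (obstacle0_le x2) _.
have := QC _ _ x2 (le_trans (norm_pt0_le a t) x2).
rewrite -!enorm_pow enorm_pt0 ler_norml => /andP[_ h].
have {}h := le_trans h (ler_wpM2l C20 (norm_pt_sub a t)).
have {}h := ler_wpM2l (ltW delta0) h.
have h1 := ler_wpM2l (ltW delta0) (barrier_ge k (pt a t)).
have h2 := g_ge a; have := mulr_ge0 (ltW (mulr_gt0 delta0 kappa_gt0)) (normr_ge0 t).
have := normr_ge0 t; move: h h1 h2; rewrite /M.
move: (`|t|) (barrier k _) (_ ^+ _) (_ ^+ _) => T B E F.
by lra.
Qed.

(** On the lateral faces |x'| >= 2, so [g] is positive by [expr2_gt_linear]; on the faces |t| = 2
    the slope outweighs -g, which is at most delta kappa. *)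
Lemma obstacle0_neg x : `|x| <= 2 -> (exists i, `|x 0 i| = 2) -> obstacle0 x < 0.
Proof.
rewrite (ptP x); move: (lsubmx x) (x 0 _) => a t x2 [i].
have [C0 _] := pC; have [C20 _] := qC.
have dC2 := mulr_ge0 (ltW delta0) C20; have dk := mulr_gt0 delta0 kappa_gt0.
have ga := g_ge a; have t0 := normr_ge0 t.
case: (split_ordP i) => j ->; rewrite ?pt_lshift ?pt_rshift => ij.
  apply: le_lt_trans (obstacle0_le x2) _.
  have : 0 <= (M - C) * `|t| by apply: mulr_ge0 => //; rewrite /M; lra.
  suff : 0 < g a by lra.
  apply: lt_le_trans ga; rewrite mulr_gt0// subr_gt0.
  have e2 : 2 <= enorm a by rewrite -ij coord_le_enorm.
  apply: (@lt_le_trans _ _ (2 ^+ (2 * k))); last first.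
    by rewrite lerXn2r ?nnegrE// (le_trans _ e2).
  exact: expr2_gt_linear.
apply: le_lt_trans (obstacle0_le x2) _; rewrite ij.
have : - (delta * kappa) <= g a.
  apply: le_trans ga; rewrite -mulrN ler_pM2l//.
  by rewrite lerDr exprn_ge0// enorm_ge0.
rewrite /M; lra.
Qed.

Lemma obstacle0_clip_neg x : 2 <= `|x| -> obstacle0 (clip x) < 0.
Proof.
by move=> /clip_boundary; apply: obstacle0_neg; exact: clip_norm.
Qed.

Lemma obstacle0_clip_lip : lip (C + M) (obstacle0 \o clip).
Proof.
have [C0 PC] := pC; have M0 := slope_ge0.
split=> [|x z /=]; first by apply: addr_ge0.
apply: le_trans (_ : (C + M) * `|clip x - clip z| <= _); last first.
  by apply: ler_wpM2l; [exact: addr_ge0|exact: clip_lip].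
move: (clip x) (clip z) (clip_norm x) (clip_norm z) => y w y2 w2.
have h1 := PC _ _ y2 w2.
have h2 : M * `| `|xt y| - `|xt w| | <= M * `|y - w|.
  apply: ler_wpM2l => //; apply: le_trans (ler_dist_dist _ _) _.
  by have := normr_coord (y - w) (rshift n 0); rewrite mxE [X in _ + X]mxE.
have -> : obstacle0 y - obstacle0 w =
    - (peval p y - peval p w) - M * (`|xt y| - `|xt w|).
  by rewrite /obstacle0; ring.
apply: le_trans (ler_normB _ _) _.
rewrite normrN normrM (ger0_norm M0) [(C + M) * _]mulrDl.
exact: lerD.
Qed.

Lemma obstacle_lip : lip (C + M) obstacle.
Proof.
have [L0 h] := obstacle0_clip_lip; split => // x z.
apply: le_trans (h x z); rewrite /obstacle /=.
move: (obstacle0 _) (obstacle0 _) => c d.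
have [hc|/ltW hc] := lerP 0 c; have [hd|/ltW hd] := lerP 0 d;
  rewrite ?(max_r hc) ?(max_r hd) ?(max_l hc) ?(max_l hd) //.
- by rewrite sub0r normrN (ger0_norm hc) distrC ger0_norm; lra.
- by rewrite subr0 (ger0_norm hd) ger0_norm; lra.
- by rewrite subrr normr0.
Qed.

Lemma obstacle_barrier x : obstacle x <= delta * barrier k x.
Proof.
rewrite /obstacle ge_max mulr_ge0 ?barrier_ge0 ?(ltW delta0)//=.
have [x2|x2] := leP `|x| 2; first by rewrite clip_id// obstacle0_barrier.
apply: le_trans (ltW (obstacle0_clip_neg (ltW x2))) _.
by rewrite mulr_ge0 ?barrier_ge0 ?(ltW delta0).
Qed.

Lemma obstacle_flip x : obstacle (signed_shift flip 0 x) = obstacle x.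
Proof.
rewrite /obstacle clip_flip; congr Num.max.
rewrite (ptP (clip x)) flipE /obstacle0 /xt !pt_rshift normrN.
by rewrite [in RHS]p_even.
Qed.

End Obstacle.
End Solution.

Section PerronHarmonic.
Context {R : realType} {N : nat} (N0 : (0 < N)%N).
Context (Psi w0 : 'rV[R]_N -> R) (L : R) (lPsi : lip L Psi).
Hypothesis w0S : supersol Psi w0.
Implicit Types (x y z : 'rV[R]_N).

Let G := perron Psi.

Lemma harmonic_min_principle H (P : mpol N R) y s : 0 < s -> continuous H ->
  C2_on (dball y s) H -> (forall x, dball y s x -> laplacian H x = 0) ->
  plap P = 0 -> (forall x, peval (sqdist y) x = s -> peval P x <= H x) ->
  forall x, dball y s x -> peval P x <= H x.
Proof.
move=> s0 cH C2H lapH hP PH x xs.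
apply: (comparison N0 s0 _ _ _ _ _ PH (dball_cball xs)).
- by move=> z _; exact: continuous_peval.
- by move=> z _; exact: cH.
- exact: C2_on_peval.
- by move=> z _; rewrite laplacian_peval hP peval0.
- apply: C2_superharmonic_visc => //; first exact: open_dball.
  by move=> z /lapH ->.
Qed.

(** Both 0 and [P] are harmonic, so whatever lies above them on a small sphere stays above them
    inside. The lift thus respects the obstacle even where [G] touches it. *)
Lemma perron_harmonic_max (P : mpol N R) x : plap P = 0 ->
  (\forall z \near x, Psi z = Num.max 0 (peval P z)) ->
  exists s, [/\ 0 < s, C2_on (dball x s) G &
    forall z, dball x s z -> laplacian G z = 0].
Proof.
move=> hP /nbhs_cball[s s0 sP].
have [] := perron_lift N0 lPsi w0S (y := x) s0; last by exists s.
move=> H cH C2H lapH PsiH _ z zs.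
have sphere c : peval (sqdist x) c = s -> Psi c = Num.max 0 (peval P c).
  by move=> cs; apply: sP; rewrite /cball /= cs.
rewrite (sP _ (dball_cball zs)) ge_max; apply/andP; split.
  rewrite -(peval0 (N := N) z); apply: harmonic_min_principle zs => //.
    exact: plap0.
  move=> c cs; rewrite peval0; apply: le_trans (PsiH c cs).
  by rewrite sphere// le_max lexx.
apply: harmonic_min_principle zs => // c cs; apply: le_trans (PsiH c cs).
by rewrite sphere// le_max lexx orbT.
Qed.

(** Near [x] a constant [m] separates [Psi] from [G]; by the minimum principle the lift stays above
    [m], hence above the obstacle. *)
Lemma perron_harmonic_gap x : Psi x < G x ->
  exists s, [/\ 0 < s, C2_on (dball x s) G &
    forall z, dball x s z -> laplacian G z = 0].
Proof.
move=> PG; pose m := (Psi x + G x) / 2.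
have m1 : Psi x < m by rewrite /m; lra.
have m2 : m < G x by rewrite /m; lra.
have cPsi : Psi @ x --> Psi x by exact: (lip_continuous lPsi).
have cG : G @ x --> G x by exact: (lip_continuous (perron_lip lPsi w0S)).
have /nbhs_cball[s s0 sP] : nbhs x ([set z | Psi z < m] `&` [set z | m < G z]).
  apply: filterI.
    by apply: (cPsi [set r | r < m]); apply: open_nbhs_nbhs; split; [exact: open_lt|].
  by apply: (cG [set r | m < r]); apply: open_nbhs_nbhs; split; [exact: open_gt|].
have [] := perron_lift N0 lPsi w0S (y := x) s0; last by exists s.
move=> H cH C2H lapH _ HG z zs.
have [/ltW zm _] := sP z (dball_cball zs); apply: le_trans zm _.
rewrite -(pevalC (N := N) m z); apply: harmonic_min_principle zs => //.
  exact: plapC.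
move=> c cs; rewrite pevalC HG//; have [|_ /ltW//] := sP c.
by rewrite /cball /= cs.
Qed.

End PerronHarmonic.

Lemma thin_solution {R : realType} {n : nat} (hn : (2 <= n)%N)
    (p : mpol (n + 1) R) (g : 'rV[R]_n -> R) (delta : R) (k : nat) :
  plap p = 0 -> (forall a, peval p (pt a 0) = g a) ->
  (forall a t, peval p (pt a t) = peval p (pt a (- t))) ->
  0 < delta -> (0 < k)%N ->
  (forall a, delta * (enorm a ^+ (2 * k) - (1 + (2 * k)%:R)) <= g a) ->
  exists G : 'rV[R]_(n + 1) -> R, [/\ forall x, 0 <= G x,
    forall x, G x <= delta * barrier k x &
    global_solution (fun x => G x + peval p x)].
Proof.
move=> hp p_thin p_even d0 k0 g_ge.
have N3 : (3 <= n + 1)%N by rewrite addn1.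
have N0 : (0 < n + 1)%N by rewrite addn1.
have [C C0 PC] := poly_lip_cube p (ler0n R 2).
have [C2 C20 QC] := poly_lip_cube (sqdist (0 : 'rV[R]_(n + 1)) ^+ k) (ler0n R 2).
have pC := conj C0 PC; have qC := conj C20 QC.
pose M : R := C + delta * C2 + delta * (1 + (2 * k)%:R) + 1.
pose Psi0 := obstacle0 p delta k C C2; pose Psi := obstacle p delta k C C2.
have lPsi : lip (C + M) Psi by exact: obstacle_lip.
have PsiE x : Psi x = Num.max 0 (Psi0 (clip x)) by [].
have bS : supersol Psi (fun x => delta * barrier k x).
  split.
  - move=> x; apply: continuousM; first exact: cst_continuous.
    exact: barrier_continuous.
  - by apply: visc_scale => //; exact: barrier_superharmonic.
  - by move=> x; exact: (obstacle_barrier p_thin).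
pose G := perron Psi.
have G0 x : 0 <= G x.
  by apply: le_trans (perron_ge bS x); rewrite PsiE le_max lexx.
have lG : lip (C + M) G by exact: perron_lip lPsi bS.
have clip_neg x : 2 <= `|x| -> Psi0 (clip x) < 0.
  by move=> x2; exact: (obstacle0_clip_neg p_thin).
pose u x := G x + peval p x.
have u0 a : 0 <= u (pt a 0).
  (* In the cube the obstacle is at least -p on the thin space; beyond it p >= 0 there and G >=
     0. *)
  rewrite /u; have [a2|a2] := leP `|pt a 0 : 'rV[R]_(n + 1)| 2.
    rewrite addrC -lerBlDl sub0r; apply: le_trans (perron_ge bS _).
    rewrite PsiE clip_id// le_max /Psi0 /obstacle0 pt_rshift normr0 mulr0 subr0.
    by rewrite lexx orbT.
  rewrite p_thin addr_ge0//; apply: le_trans (g_ge a); rewrite mulr_ge0 ?(ltW d0)//.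
  rewrite subr_ge0; have e2 : 2 <= enorm a.
    rewrite -enorm_pt0; apply: le_trans (norm_le_enorm _); exact: ltW.
  apply: (@le_trans _ _ (2 ^+ (2 * k))); last first.
    by rewrite lerXn2r ?nnegrE// (le_trans _ e2).
  exact/ltW/expr2_gt_linear.
have near_lt (f : 'rV[R]_(n + 1) -> R) (c : R) x : continuous f -> f x < c ->
    \forall z \near x, f z < c.
  move=> cf fx; have fc : f @ x --> f x by exact: cf.
  by apply: (fc [set r | r < c]); apply: open_nbhs_nbhs; split; [exact: open_lt|].
have Gharm x : ~ contact_set u x -> exists s, [/\ 0 < s, C2_on (dball x s) G &
    forall z, dball x s z -> laplacian G z = 0].
  (* Where the clipped obstacle is negative, in particular outside the open cube, [Psi] is locally
     0, and [perron_harmonic_max] applies with the zero polynomial. *)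
  move=> xu; have [neg|nneg] := ltP (Psi0 (clip x)) 0.
    apply: (perron_harmonic_max N0 lPsi bS (P := 0)).
      exact: plap0.
    have cPsi : continuous (Psi0 \o clip).
      by apply: (lip_continuous (L := C + M)); exact: obstacle0_clip_lip.
    apply: filterS (near_lt _ _ _ cPsi neg) => z /ltW /= zneg.
    by rewrite PsiE peval0 maxxx max_l.
  have x2 : `|x| < 2 by rewrite ltNge; apply/negP => /clip_neg; rewrite ltNge nneg.
  have cx : clip x = x by rewrite clip_id// ltW.
  have near2 : \forall z \near x, `|z| < 2.
    by apply: near_lt => // z; exact: norm_continuous.
  have [t0|t0] := eqVneq (x 0 (rshift n 0)) 0.
    apply: (perron_harmonic_gap N0 lPsi bS).
    (* Here [Psi] equals -p at [x], so equality with [G] would put [x] in the contact set. *)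
    rewrite lt_neqAle (perron_ge bS) andbT; apply/eqP => PG.
    apply: xu; exists (lsubmx x) => /=; last by rewrite [RHS]ptP t0.
    rewrite -{1}t0 -ptP /u /G -PG PsiE max_r// cx /Psi0 /obstacle0 t0 normr0 mulr0 subr0.
    by rewrite addNr.
  (* Off the thin space the last coordinate keeps its sign near [x]; there |x_(n+1)| is linear and
     the obstacle is the maximum of 0 and a harmonic polynomial. *)
  pose sg : R := Num.sg (x 0 (rshift n 0)).
  pose P : mpol (n + 1) R := - p - (M * sg) *: mvar (rshift n 0).
  apply: (perron_harmonic_max N0 lPsi bS (P := P)).
    rewrite /P plapB plapN hp oppr0 plapZ plap_degle1 ?scaler0 ?subr0//.
    exact: degleX.
  have nsg : nbhs x [set z : 'rV[R]_(n + 1) |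
      `|z 0 (rshift n 0)| = sg * z 0 (rshift n 0)].
    have cc : continuous (fun z : 'rV[R]_(n + 1) => - sg * z 0 (rshift n 0)).
      move=> z; apply: (@continuousM _ _ (fun=> - sg)); first exact: cst_continuous.
      exact: coord_continuous.
    have : - sg * x 0 (rshift n 0) < 0.
      by rewrite mulNr oppr_lt0 -normrEsg normr_gt0.
    move=> /(near_lt _ _ _ cc); apply: filterS => z.
    rewrite mulNr oppr_lt0 => h.
    rewrite /= -(gtr0_norm h) normrM /sg.
    by rewrite normr_sg t0 mul1r.
  near=> z.
  have z2 : `|z| < 2 by near: z; exact: near2.
  have zs : `|z 0 (rshift n 0)| = sg * z 0 (rshift n 0) by near: z; exact: nsg.
  rewrite PsiE clip_id ?ltW// /Psi0 /obstacle0 zs /P pevalB pevalN pevalZ pevalX.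
  by rewrite mulrA.
exists G; split=> // [x|]; first exact: (perron_le bS x bS).
split.
- move=> x; apply: continuousD; last exact: continuous_peval.
  exact: (lip_continuous lG).
- exact: u0.
- have loc x : ~ contact_set u x -> exists s,
      [/\ 0 < s, C2_on (dball x s) u & laplacian u x = 0].
    move=> /Gharm[s [s0 C2G lapG]]; exists s.
    have [C2' lap'] := C2_on_lin 1 (@open_dball _ _ x s) C2G
      (C2_on_peval (A := dball x s) p).
    have uE : (fun x => 1 * G x + peval p x) = u.
      by apply/funext => z; rewrite mul1r.
    rewrite uE in C2' lap'; split=> //.
    have xs : dball x s x by exact: dball_center.
    by rewrite lap'// lapG// laplacian_peval hp peval0 mulr0 addr0.
  split=> x xu; have [s [s0 C2u lapu]] := loc x xu => //.
  by apply: C2u; exact: dball_center.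
- apply: (@visc_add_harmonic _ _ G p hp).
  exact: (perron_superharmonic N0 bS).
- move=> a t; rewrite -[in RHS]flipE.
  have -> : peval p (signed_shift flip 0 (pt a t)) = peval p (pt a t).
    by rewrite flipE -p_even.
  congr (_ + _); apply/esym; apply: (perron_sym bS) => [i|x].
    exact: flip_sign.
  exact: obstacle_flip.
Unshelve. all: by end_near. Qed.

(** * Approximation of zero sets by contact sets *)

Section GrowthOrder.
Context {R : realType} {N : nat}.
Implicit Types (u : 'rV[R]_N -> R) (x : 'rV[R]_N).

Lemma polynomial_growthP u m : polynomial_growth u m <->
  exists C : R, forall x, `|u x| <= C * (1 + enorm x ^+ m).
Proof.
have e0 x : 0 < 1 + enorm x ^+ m by rewrite ltr_pwDl// exprn_ge0// enorm_ge0.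
have E x : `|u x / (1 + enorm x ^+ m)| = `|u x| / (1 + enorm x ^+ m).
  by rewrite normrM normfV (gtr0_norm (e0 x)).
split=> [um|[C uC]].
  have [C uC] : exists C : R, (ereal_sup (range (fun x =>
      `|u x / (1 + enorm x ^+ m)|%:E)) <= C%:E)%E.
    move: um; rewrite /polynomial_growth; case: ereal_sup => [C _|//|_].
      by exists C.
    by exists 0; rewrite leNye.
  exists C => x; rewrite -ler_pdivrMr// -E -lee_fin; apply: le_trans uC.
  by apply: ereal_sup_ubound; exists x.
rewrite /polynomial_growth; apply: (@le_lt_trans _ _ C%:E); last by rewrite ltry.
apply: ge_ereal_sup => _ [x _ <-].
by rewrite lee_fin E ler_pdivrMr.
Qed.

Lemma expr_1D_le (r : R) d : 0 <= r -> (1 + r) ^+ d <= 2 ^+ d * (1 + r ^+ d).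
Proof.
move=> r0; rewrite mulrDr mulr1 -exprMn; have [r1|r1] := leP r 1.
  apply: ler_wpDr; first by rewrite exprn_ge0// mulr_ge0.
  by rewrite lerXn2r ?nnegrE ?addr_ge0//; lra.
apply: ler_wpDl; first by rewrite exprn_ge0.
by rewrite lerXn2r ?nnegrE ?addr_ge0 ?mulr_ge0//; lra.
Qed.

Lemma polynomial_growth_order_exists u m : polynomial_growth u m ->
  exists k, polynomial_growth_order u k.
Proof.
move=> um; have ex : exists k, `[< polynomial_growth u k >] by exists m; apply/asboolP.
exists (ex_minn ex); case: ex_minnP => k /asboolP uk kmin; split => // j uj.
by apply: kmin; apply/asboolP.
Qed.

Lemma enorm_subC x (y : 'rV[R]_N) : enorm (x - y) ^+ 2 = peval (sqdist y) x.
Proof.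
rewrite enorm_sqr !peval_sqdist; apply: eq_bigr => i _.
by rewrite !mxE subr0.
Qed.

(** On the compact set [K] of points of the ball at distance at least [eps] from all zeros, [f] has
    a positive minimum, and [c] is half of it. If [f] has no zero, [K] is the whole ball and the
    bound [peval f x <= c] never holds. *)
Lemma zero_set_nbhd (f : mpol N R) (r eps : R) : 0 < eps -> 0 <= r ->
  (forall x, 0 <= peval f x) -> exists2 c : R, 0 < c &
  forall x, enorm x <= r -> peval f x <= c ->
    (edist_to (zero_set f) x <= eps%:E)%E.
Proof.
move=> eps0 r0 f0.
pose K := cball (0 : 'rV[R]_N) (r ^+ 2) `&`
  \bigcap_(y in zero_set f) [set x | eps ^+ 2 <= peval (sqdist y) x].
have near x : enorm x <= r -> ~ K x -> (edist_to (zero_set f) x <= eps%:E)%E.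
  move=> xr /not_andP[|].
    by case; rewrite /cball /= -enorm_sqr lerXn2r ?nnegrE ?enorm_ge0.
  move=> /existsNP[y /not_implyP[fy /negP]]; rewrite -ltNge -enorm_subC => xy.
  apply: (@le_trans _ _ (enorm (x - y))%:E).
    by apply: ereal_inf_lbound; exists y.
  rewrite lee_fin ltW//; move: xy; rewrite ltr_pXn2r ?nnegrE ?enorm_ge0//.
  exact: ltW.
have [[a Ka]|K0] := pselect (K !=set0); last first.
  exists 1 => // x xr _; apply: near => // Kx.
  by apply: K0; exists x.
have cK : compact K.
  apply: subclosed_compact (@compact_cball _ _ 0 (r ^+ 2)) _ => [|x []//].
  apply: closedI; first exact: closed_cball.
  apply: closed_bigI => y _.
  have -> : [set x | eps ^+ 2 <= peval (sqdist y) x] =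
    peval (sqdist y) @^-1` [set t | eps ^+ 2 <= t] by [].
  by apply: closed_comp => [z _|]; [exact: continuous_peval|exact: closed_ge].
have [b Kb bmin] : exists2 b, b \in K & forall x, x \in K -> peval f b <= peval f x.
  apply: compact_EVT_min => //; first by exists a.
  by apply: continuous_subspaceT; exact: continuous_peval.
have fb : 0 < peval f b.
  rewrite lt_neqAle f0 andbT; apply/eqP => fb.
  move: Kb; rewrite inE => -[_ /(_ b)]; rewrite /= sqdistxx => /(_ (esym fb)).
  by rewrite leNgt exprn_gt0.
exists (peval f b / 2) => [|x xr fx]; first exact: divr_gt0.
apply: near => // Kx; have := bmin x; rewrite inE => /(_ Kx); move: fx fb; lra.
Qed.

End GrowthOrder.

Lemma approximating_solution (R : realType) (n : nat) (hn : (2 <= n)%N)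
    (f : mpol n R) (m k : nat) (eps r : R) : degle f m ->
  (forall a : 'rV[R]_n, 0 <= peval f a) -> 0 < eps -> (0 < k)%N -> 0 <= r ->
  1 + (2 * k)%:R < r ^+ (2 * k) ->
  exists (u : 'rV[R]_(n + 1) -> R) (C : R), [/\ global_solution u,
    polynomial_growth u (maxn m (2 * k)),
    forall a, peval f a <= u (pt a 0) + C &
    contact_set_approximates f eps r u].
Proof.
move=> fm f0 eps0 k0 r0 rk.
have [c c0 near] := zero_set_nbhd eps0 r0 f0.
pose kappa : R := 1 + (2 * k)%:R; have kappa0 : 0 < kappa by rewrite ltr_pwDl.
(* On the contact set f + delta |x'|^(2k) <= delta kappa; this choice makes the right side the
   threshold [c] of the neighbourhood lemma. *)
pose delta := c / kappa; have delta0 : 0 < delta by rewrite divr_gt0.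
have dk : delta * kappa = c by rewrite /delta divfK// gt_eqF.
clearbody delta.
pose g := f + delta *: (sqdist 0 ^+ k - mpoly.mpolyC n kappa).
have gE a : peval g a = peval f a + delta * (enorm a ^+ (2 * k) - kappa).
  by rewrite /g pevalD pevalZ pevalB pevalC enorm_pow.
have gd : degle g (maxn m (2 * k)).
  apply: degleD; first by apply: degleW fm; rewrite leq_maxl.
  rewrite -mpoly.mul_mpolyC -[maxn _ _]add0n; apply: degleM; first exact: degleC.
  apply: degleD; last by apply: degleN; exact: degleC.
  apply: (@degleW _ _ _ (2 * k)); first by rewrite leq_maxr.
  elim: (k) => [|j IHj]; first by rewrite expr0 -(mpoly.mpolyC1 n R) degleC.
  by rewrite exprS mulnS degleM// degle_sqdist.
have [p [hp p_thin p_even [C C0 pC]]] := even_extension gd.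
have g_ge a : delta * (enorm a ^+ (2 * k) - (1 + (2 * k)%:R)) <= peval g a.
  by rewrite gE lerDr.
have [G [G0 Gle sol]] := thin_solution hn hp p_thin p_even delta0 k0 g_ge.
exists (fun x => G x + peval p x), (delta * kappa).
have u0 := gs_ge0 sol.
split=> //.
- apply/polynomial_growthP; exists (delta * kappa + C * 2 ^+ (maxn m (2 * k))) => x.
  apply: le_trans (ler_normD _ _) _; rewrite mulrDl; apply: lerD.
    rewrite ger0_norm//; apply: le_trans (Gle x) _.
    apply: (@le_trans _ _ (delta * kappa)); first by rewrite ler_pM2l// barrier_le.
    by rewrite ler_peMr ?mulr_ge0 ?(ltW delta0) ?(ltW kappa0)// lerDl exprn_ge0// enorm_ge0.
  apply: le_trans (pC x) _; rewrite -mulrA ler_wpM2l//.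
  by rewrite expr_1D_le// enorm_ge0.
- move=> a; rewrite p_thin gE.
  have := G0 (pt a 0); have : 0 <= delta * enorm a ^+ (2 * k).
    by rewrite mulr_ge0 ?(ltW delta0)// exprn_ge0// enorm_ge0.
  lra.
split=> [x [[a fa <-]]|x [a ua <-]].
  (* At a zero of [f] in the unit ball the trace of [p] is delta q and [G] is at most -delta q, so u
     <= 0. *)
  rewrite /eball /= enorm_pt0 => a1; exists a => //=.
  apply/eqP; rewrite eq_le u0 andbT p_thin gE.
  have := Gle (pt a 0); rewrite barrier_in ?enorm_pt0 ?(ltW a1)//.
  rewrite (fa : peval f a = 0) /kappa; lra.
have ga : peval f a + delta * enorm a ^+ (2 * k) <= c.
  have := G0 (pt a 0); move: ua; rewrite /= p_thin gE -dk; lra.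
have fa : peval f a <= c.
  have : 0 <= delta * enorm a ^+ (2 * k).
    by rewrite mulr_ge0 ?(ltW delta0)// exprn_ge0// enorm_ge0.
  move: ga; lra.
have ar : enorm a < r.
  have : delta * enorm a ^+ (2 * k) <= delta * kappa.
    by rewrite dk; have := f0 a; move: ga; lra.
  rewrite ler_pM2l// => /le_lt_trans/(_ rk).
  by rewrite ltr_pXn2r ?nnegrE ?enorm_ge0// muln_gt0.
split; last by rewrite /eball /= enorm_pt0.
by exists a => //=; apply: near => //; exact: ltW.
Qed.

Lemma exp_beats_linear (R : realType) (eps : R) : 0 < eps ->
  (* For k > 3 / eps^2, Bernoulli's inequality gives (1 + eps)^(2k) >= (1 + k eps)^2 >= 1 + k^2
     eps^2 > 1 + 3k. *)
  exists2 k, (0 < k)%N & 1 + (2 * k)%:R < (1 + eps) ^+ (2 * k).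
Proof.
move=> eps0; pose k := (Num.truncn (3 / eps ^+ 2)).+1; exists k => //.
have k1 : 3 / eps ^+ 2 < k%:R by exact: truncnS_gt.
have e1 : 1 + k%:R * eps <= (1 + eps) ^+ k.
  by have := @bernoulli_ineq R (1 + eps) k; rewrite addrAC subrr add0r; apply; lra.
have kk : 1 <= k%:R :> R by rewrite ler1n.
have {}k1 : 3 < k%:R * eps ^+ 2 by rewrite -ltr_pdivrMr// exprn_gt0.
rewrite mulnC exprM; apply: (@lt_le_trans _ _ ((1 + k%:R * eps) ^+ 2)); last first.
  by rewrite lerXn2r ?nnegrE ?addr_ge0 ?mulr_ge0 ?exprn_ge0 ?addr_ge0 ?(ltW eps0).
have : 3 * k%:R < k%:R * (k%:R * eps ^+ 2) by rewrite mulrC ltr_pM2l// (lt_le_trans _ kk).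
have : 0 <= k%:R * eps by rewrite mulr_ge0// ltW.
rewrite natrM; move: (k%:R : R) kk => K kk; nra.
Qed.

Theorem proposition1p3 (R : realType) (n : nat) (hn : (2 <= n)%N) :
  (exists r : R, 1 < r /\
     forall (f : mpoly.mpoly n R) (m : nat),
       (2 <= m)%N -> has_degree f m ->
       (forall x' : 'rV[R]_n, 0 <= peval f x') ->
       forall eps : R, 0 < eps ->
       exists u : 'rV[R]_(n + 1) -> R,
         [/\ global_solution u,
             polynomial_growth_order u m &
             contact_set_approximates f eps r u]) /\
  (forall (f : mpoly.mpoly n R) (m : nat),
     (2 <= m)%N -> has_degree f m ->
     (forall x' : 'rV[R]_n, 0 <= peval f x') ->
     forall eps : R, 0 < eps ->
     exists (u : 'rV[R]_(n + 1) -> R) (m_eps : nat),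
       [/\ global_solution u,
           polynomial_growth_order u m_eps &
           contact_set_approximates f eps (1 + eps) u]).
Proof.
split.
  exists 2; split=> [|f m m2 fm f0 eps eps0]; first lra.
  have fd : degle f m by rewrite /degle fm.
  have [|||u [C [sol um fu app]]] := @approximating_solution R n hn f m 1 eps 2 fd f0 eps0.
  - by [].
  - by [].
  - exact: expr2_gt_linear.
  exists u; split=> //; split=> [|j uj].
    (* With k = 1 the order bound max(m, 2) is m, as m >= 2. *)
    by move: um; rewrite (maxn_idPl m2).
  have /polynomial_growthP[D uD] := uj.
  (* Growth of order [j] for [u], restricted to the thin space, bounds [f] there and so limits its
     degree. *)
  have : degle f j.
    apply: (@growth_degle _ _ f (D + `|C|)) => a; rewrite ger0_norm//.
    apply: le_trans (fu a) _; rewrite mulrDl; apply: lerD.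
      by apply: le_trans (ler_norm _) _; rewrite -(enorm_pt0 a).
    apply: le_trans (ler_norm _) _; rewrite ler_peMr//.
    by rewrite lerDl exprn_ge0// enorm_ge0.
  by rewrite /degle fm ltnS.
move=> f m m2 fm f0 eps eps0.
have fd : degle f m by rewrite /degle fm.
have [k k0 kk] := exp_beats_linear eps0.
have e0 : 0 <= 1 + eps by lra.
have [u [C [sol um _ app]]] := approximating_solution hn fd f0 eps0 k0 e0 kk.
(* The order is the least exponent that works; max(m, 2k) is one such exponent. *)
have [m_eps um_eps] := polynomial_growth_order_exists um.
by exists u, m_eps.
Qed.
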